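(* Let $n,p\ge1$ be integers with $n-p-1>0$. If $-n-p+1\le\alpha\le-2p$ and $\beta\ge0$, then the prior $$\pi_{\alpha,\beta}(M)=\det(M^\top M+\beta I_p)^{-(\alpha+n+p-1)/2},\qquad M\in\mathbb{R}^{n\times p},$$ is matrix superharmonic.
   Context: Here $\alpha,\beta$ are real. Convention: when $\det(M^\top M+\beta I_p)=0$, the value $\pi_{\alpha,\beta}(M)$ is $+\infty$ if $\alpha+n+p-1>0$, and $\pi_{\alpha,\beta}\equiv1$ if $\alpha+n+p-1=0$. Let $S_{0,1}=\{e\in\mathbb{R}^n:\|e\|=1\}$ with surface element $ds$ and surface area $\Omega_n$. For $f:\mathbb{R}^{n\times p}\to\mathbb{R}\cup\{\infty\}$, $X\in\mathbb{R}^{n\times p}$, $\rho\in\mathbb{R}^p$, put $L(f:X,\rho)=\frac{1}{\Omega_n}\int_{S_{0,1}}f(X+e\rho^\top)\,ds(e)$. The function $f$ is matrix superharmonic if (1) $f$ is lower semicontinuous; (2) $f\not\equiv\infty$; (3) $L(f:X,\rho)\le f(X)$ for every $X\in\mathbb{R}^{n\times p}$ and $\rho\in\mathbb{R}^p$. *)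

(* Defs.v *)
From HB Require Import structures.
From mathcomp Require Import all_boot all_order all_algebra.
From mathcomp Require Import all_classical all_reals all_analysis.
From mathcomp Require Import measurable_realfun.

Set Implicit Arguments.
Unset Strict Implicit.
Unset Printing Implicit Defensive.

Import Order.TTheory GRing.Theory Num.Theory.
Import numFieldNormedType.Exports.

Local Open Scope classical_set_scope.
Local Open Scope ring_scope.

(* The library has neither Lebesgue measure on R^n nor surface measure on the
   unit sphere.  Both are built here on [n.-tuple R], which carries the
   product sigma-algebra of the library. *)

Section lebesgue_tuple.
Context {R : realType}.
Local Open Scope ereal_scope.

Definition tuple_cons n (z : R * n.-tuple R) : n.+1.-tuple R :=
  [tuple of z.1 :: z.2].

Lemma measurable_tuple_cons n : measurable_fun [set: R * n.-tuple R]
  (@tuple_cons n : R * n.-tuple R -> n.+1.-tuple R).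
Proof. by apply: measurable_cons; [exact: measurable_fst|exact: measurable_snd]. Qed.

Section step.
Variables (n : nat) (mu : {sigma_finite_measure set (n.-tuple R) -> \bar R}).

Definition lebesgue_cons : set (n.+1.-tuple R) -> \bar R :=
  pushforward (@lebesgue_measure R \x mu) (@tuple_cons n).

Let lebesgue_cons0 : lebesgue_cons set0 = 0.
Proof. by rewrite /lebesgue_cons /pushforward preimage_set0 measure0. Qed.

Let lebesgue_cons_ge0 A : 0 <= lebesgue_cons A.
Proof. by rewrite /lebesgue_cons /pushforward; exact: measure_ge0. Qed.

Let lebesgue_cons_sigma_additive : semi_sigma_additive lebesgue_cons.
Proof.
move=> F mF tF mUF; rewrite /lebesgue_cons /pushforward preimage_bigcup.
have mp := @measurable_tuple_cons n.
apply: measure_semi_sigma_additive.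
- by move=> k; rewrite -[X in measurable X]setTI; exact: mp.
- apply/trivIsetP => /= i j _ _ ij; rewrite -preimage_setI.
  by move/trivIsetP : tF => /(_ _ _ _ _ ij) ->//; rewrite preimage_set0.
- by rewrite -preimage_bigcup -[X in measurable X]setTI; exact: mp.
Qed.

HB.instance Definition _ := isMeasure.Build _ _ _ lebesgue_cons
  lebesgue_cons0 lebesgue_cons_ge0 lebesgue_cons_sigma_additive.

Let lebesgue_cons_sigma_finite : sigma_finite setT lebesgue_cons.
Proof.
have /sigma_finiteP[F [TF ndF Foo]] := sigma_finiteT (@lebesgue_measure R).
have /sigma_finiteP[G [TG ndG Goo]] := sigma_finiteT mu.
pose uncons (t : n.+1.-tuple R) : R * n.-tuple R :=
  (thead t, [tuple of behead t]).
have muncons : measurable_fun [set: n.+1.-tuple R] uncons.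
  apply/measurable_fun_pairP; split; first exact: measurable_tnth.
  exact: measurable_behead.
have unconsK z : uncons (tuple_cons z) = z.
  by case: z => x t; congr pair; exact/val_inj.
exists (fun k => uncons @^-1` (F k `*` G k)).
  rewrite -preimage_bigcup; apply/seteqP; split => t //= _.
  have [i _ Fi] : (\bigcup_i F i) (uncons t).1 by rewrite -TF.
  have [j _ Gj] : (\bigcup_j G j) (uncons t).2 by rewrite -TG.
  exists (maxn i j) => //; split.
    by move: Fi; exact/subsetPset/ndF/leq_maxl.
  by move: Gj; exact/subsetPset/ndG/leq_maxr.
move=> k; have [mFk Fkoo] := Foo k; have [mGk Gkoo] := Goo k; split.
  by rewrite -[X in measurable X]setTI; apply: muncons => //; exact: measurableX.
rewrite /lebesgue_cons /pushforward -comp_preimage.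
rewrite (_ : uncons \o _ = id) ?preimage_id; last exact/funext.
by rewrite product_measure1E// lte_mul_pinfty// ge0_fin_numE.
Qed.

HB.instance Definition _ := Measure_isSigmaFinite.Build _ _ _ lebesgue_cons
  lebesgue_cons_sigma_finite.

End step.

(* the n-fold product of Lebesgue measure on R *)
Fixpoint lebesgue_tuple n : {sigma_finite_measure set (n.-tuple R) -> \bar R} :=
  match n with
  | 0 => \d_ [tuple]
  | m.+1 => lebesgue_cons (lebesgue_tuple m)
  end.

End lebesgue_tuple.

Section sphere.
Context {R : realType}.

(* The library norm `|_| on vectors is the sup norm. *)
Definition eucl_norm n (x : n.-tuple R) : R :=
  Num.sqrt (\sum_(i < n) tnth x i ^+ 2).

Definition unit_sphere n : set (n.-tuple R) := [set e | eucl_norm e = 1].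
Arguments unit_sphere n _ : clear implicits.

Definition normalize n (x : n.-tuple R) : n.-tuple R :=
  [tuple tnth x i / eucl_norm x | i < n].

Lemma measurable_eucl_norm n :
  measurable_fun [set: n.-tuple R] (@eucl_norm n).
Proof.
apply: (@measurableT_comp _ _ _ _ _ _ (@Num.sqrt R)).
  by apply: continuous_measurable_fun; exact: sqrt_continuous.
apply: measurable_sum => i; apply: measurable_funX; exact: measurable_tnth.
Qed.

Lemma measurable_normalize n :
  measurable_fun [set: n.-tuple R] (@normalize n).
Proof.
apply/measurable_fun_tnthP => i.
rewrite (_ : _ \o _ =
    (fun x : n.-tuple R => tnth x i * eucl_norm x `^ (-1))); last first.
  by apply/funext => x /=; rewrite tnth_mktuple powR_inv1// sqrtr_ge0.
apply: measurable_funM; first exact: measurable_tnth.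
apply: (@measurableT_comp _ _ _ _ _ _ (@powR R ^~ (-1))).
  exact: measurable_powR.
exact: measurable_eucl_norm.
Qed.

(* the part of the closed unit ball, origin removed, that projects radially
   into A *)
Definition cone n (A : set (n.-tuple R)) : set (n.-tuple R) :=
  [set x | 0 < eucl_norm x <= 1 /\ A (normalize x)].

Lemma measurable_cone n (A : set (n.-tuple R)) :
  measurable A -> measurable (cone A).
Proof.
move=> mA.
rewrite (_ : cone A =
  (@eucl_norm n) @^-1` `]0, 1]%classic `&` (@normalize n) @^-1` A).
  apply: measurableI; rewrite -[X in measurable X]setTI.
    exact: measurable_eucl_norm.
  exact: measurable_normalize.
by apply/seteqP; split => x /=; rewrite in_itv.
Qed.

Section surface_measure.
Variable n : nat.
Local Open Scope ereal_scope.

(* Surface element of the unit sphere of R^n, obtained from Lebesgue measure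
   through polar coordinates dx = r^(n-1) dr ds(e), which give
   |cone A| = s(A) * \int_0^1 r^(n-1) dr = s(A) / n. *)
Definition surface_measure (A : set (n.-tuple R)) : \bar R :=
  n%:R%:E * lebesgue_tuple n (cone A).

Let surface_measure0 : surface_measure set0 = 0.
Proof.
rewrite /surface_measure (_ : cone set0 = set0) ?measure0 ?mule0//.
by apply/seteqP; split => x // -[].
Qed.

Let surface_measure_ge0 A : 0 <= surface_measure A.
Proof. by apply: mule_ge0; [rewrite lee_fin|exact: measure_ge0]. Qed.

Let surface_measure_sigma_additive : semi_sigma_additive surface_measure.
Proof.
move=> F mF tF mUF.
have coneU : cone (\bigcup_k F k) = \bigcup_k cone (F k).
  apply/seteqP; split => x; first by move=> [x1 [k _ Fkx]]; exists k.
  by move=> [k _ [x1 Fkx]]; split => //; exists k.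
rewrite [X in X @ _ --> _](_ : _ = (fun k => n%:R%:E *
    (\sum_(0 <= i < k) lebesgue_tuple n (cone (F i))))); last first.
  by apply/funext => k; rewrite ge0_sume_distrr.
rewrite /surface_measure coneU; apply: cvgeZl => //.
apply: measure_semi_sigma_additive.
- by move=> k; exact: measurable_cone.
- apply/trivIsetP => i j _ _ ij; apply/seteqP; split => // x [[_ Fix] [_ Fjx]].
  move/trivIsetP : tF => /(_ _ _ I I ij) F0.
  by have : (F i `&` F j) (normalize x) by []; rewrite F0.
- by rewrite -coneU; exact: measurable_cone.
Qed.

HB.instance Definition _ := isMeasure.Build _ _ _ surface_measure
  surface_measure0 surface_measure_ge0 surface_measure_sigma_additive.

Definition surface_area : \bar R := surface_measure (unit_sphere n).

End surface_measure.

End sphere.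

Arguments unit_sphere R n _ : clear implicits.
Arguments surface_measure R n _ : clear implicits.
Arguments surface_area R n : clear implicits.

Section matrix_superharmonic.
Context {R : realType}.
Local Open Scope ereal_scope.

(* [surface_area R n] is finite, so [fine] loses nothing.  The integral is that
   of an extended-real function and may be +oo. *)
Definition sphere_mean n p (f : 'M[R]_(n, p) -> \bar R) (X : 'M[R]_(n, p))
    (rho : 'cV[R]_p) : \bar R :=
  ((fine (surface_area R n))^-1)%:E *
  \int[surface_measure R n]_(e in unit_sphere R n)
    f (X + (\col_i tnth e i) *m rho^T)%R.

(* The first clause renders the codomain R \cup {oo} inside \bar R. *)
Definition matrix_superharmonic n p (f : 'M[R]_(n, p) -> \bar R) : Prop :=
  [/\ forall X, f X != -oo,
      lower_semicontinuous f,
      exists X, f X != +oo &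
      forall X rho, sphere_mean f X rho <= f X].

(* As 0 `^ 0 = 1, the second branch also covers a singular matrix with a zero
   exponent. *)
Definition prior n p (alpha beta : R) (M : 'M[R]_(n, p)) : \bar R :=
  let d := \det (M^T *m M + beta%:M)%R in
  let k := (alpha + n%:R + p%:R - 1)%R in
  if (d == 0%R) && (0 < k)%R then +oo else (d `^ (- k / 2))%:E.

End matrix_superharmonic.

(* Main.v *)
(* Replacing X by X + v rho^T multiplies det(X^T X + beta I) by a quadratic
   polynomial q(v) = 1 + 2 g.v + v^T A v, by Sylvester's identity.  The upper
   bound on alpha gives
     2 (c + 1) |g + A v|^2 <= q(v) tr A   with c = (alpha + n + p - 1) / 2,
   that is, the superharmonicity of q^(-c) as a function of v in R^n; indeed
   tr A >= (n - p + 1) a and |g + A v|^2 <= a q(v), where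
   a = rho^T (X^T X + beta I)^-1 rho.

   For beta > 0 the mean value inequality on spheres is obtained as follows.
   Let I(s) be the mean of G = q^(-c) over the sphere of radius s.  The
   Laplacian of G at s e is its radial part G_rr + (n - 1) / s G_r plus s^-2
   times the sum over i < j of L_ij^2 G, with L_ij the generators of the plane
   rotations.  The surface measure is invariant under plane rotations (each is
   a product of three shears, and shears preserve Lebesgue measure by Fubini),
   so L_ij^2 G has mean 0, whence s I'' + (n - 1) I' <= 0.  Therefore
   (s - s^(n-1)) I'(s) + (n - 2) I(s) is nonincreasing on [0, 1]; its values
   at 0 and 1 are (n - 2) I(0) and (n - 2) I(1).

   For beta = 0, apply Fatou's lemma to the sequence beta = 1 / (m + 1). *)

Require Import Defs.
From HB Require Import structures.
From mathcomp Require Import all_boot all_order all_algebra.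
From mathcomp Require Import all_classical all_reals all_analysis.
From mathcomp Require Import measurable_realfun.
From mathcomp Require Import ring lra zify.

Set Implicit Arguments.
Unset Strict Implicit.
Unset Printing Implicit Defensive.

Import Order.TTheory GRing.Theory Num.Theory.
Import numFieldNormedType.Exports.

Local Open Scope classical_set_scope.
Local Open Scope ring_scope.

(** * Rotation invariance of the surface measure *)

Section shear.
Context {R : realType}.

Lemma lebesgue_measure_translation (a : R) (A : set (measurableTypeR R)) :
  measurable A ->
  lebesgue_measure ((fun x : R => x + a) @^-1` A) = lebesgue_measure A.
Proof.
move=> mA.
have mt : measurable_fun [set: measurableTypeR R] (fun x : R =>
  x + a : measurableTypeR R).
  exact: measurable_funD.
rewrite -[LHS]/(pushforward lebesgue_measure (fun x : measurableTypeR R =>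
  x + a : measurableTypeR R) A).
apply/esym; apply: lebesgue_measure_unique mA => X [[u v] _ <-] /=.
rewrite /pushforward.
rewrite (_ : _ @^-1` _ = `]u - a, v - a]%classic); last first.
  by apply/seteqP; split => x /=; rewrite !in_itv/= ltrBlDr lerBrDr.
by rewrite !lebesgue_measure_itv/= !lte_fin ltrD2r -!EFinB;
  congr (if _ then _%:E else _); ring.
Qed.

Definition shear n (i : 'I_n) (phi : n.-tuple R -> R) (x : n.-tuple R) :
    n.-tuple R :=
  [tuple if j == i then tnth x j + phi x else tnth x j | j < n].

Lemma measurable_shear n (i : 'I_n) phi :
  measurable_fun [set: n.-tuple R] phi ->
  measurable_fun [set: n.-tuple R] (shear i phi).
Proof.
move=> mphi; apply/measurable_fun_tnthP => j.
rewrite (_ : _ \o _ = fun x : n.-tuple R =>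
  if j == i then tnth x j + phi x else tnth x j); last first.
  by apply/funext => x /=; rewrite tnth_mktuple.
case: (j == i); last exact: measurable_tnth.
by apply: measurable_funD => //; exact: measurable_tnth.
Qed.

Lemma shear_cons0 n (phi : n.+1.-tuple R -> R) x (t : n.-tuple R) :
  shear ord0 phi (tuple_cons (x, t)) =
  tuple_cons (x + phi (tuple_cons (x, t)), t).
Proof.
apply: eq_from_tnth => k; rewrite tnth_mktuple.
have [l ->|->] := unliftP ord0 k; last by rewrite eqxx.
by rewrite !tnthS eq_sym (negbTE (neq_lift _ _)).
Qed.

Lemma shear_consS n (j : 'I_n) (phi : n.+1.-tuple R -> R) x (t : n.-tuple R) :
  shear (lift ord0 j) phi (tuple_cons (x, t)) =
  tuple_cons (x, shear j (fun u => phi (tuple_cons (x, u))) t).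
Proof.
apply: eq_from_tnth => k; rewrite tnth_mktuple.
have [l ->|->] := unliftP ord0 k; last by rewrite (negbTE (neq_lift _ _)).
by rewrite !tnthS (inj_eq lift_inj) tnth_mktuple.
Qed.

(** Induction on [n]. If [i] is not the first coordinate, fix the first coordinate and apply the
    induction hypothesis to the slices. If it is, integrate over it first: on each line in that
    direction the shear is a translation. *)
Lemma lebesgue_tuple_shear n (i : 'I_n) (phi : n.-tuple R ->
  R) (A : set (n.-tuple R)) :
  measurable_fun [set: n.-tuple R] phi ->
  (forall x y, (forall j, j != i -> tnth x j = tnth y j) -> phi x = phi y) ->
  measurable A -> lebesgue_tuple n (shear i phi @^-1` A) = lebesgue_tuple n A.
Proof.
elim: n i phi A => [[]//|n IHn] i phi A mphi indep mA.
rewrite /= /lebesgue_cons /pushforward.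
have mc := @measurable_tuple_cons R n.
have mB : measurable (@tuple_cons R n @^-1` A).
  by rewrite -[X in measurable X]setTI; exact: mc.
have mB' : measurable (@tuple_cons R n @^-1` (shear i phi @^-1` A)).
  rewrite -[X in measurable X]setTI; apply: mc => //.
  by rewrite -[X in measurable X]setTI; exact: measurable_shear.
have [j|] := unliftP ord0 i => [ij|i0].
- rewrite /product_measure1; apply: eq_integral => x _ /=.
  rewrite -[RHS](IHn j (fun t => phi (tuple_cons (x, t)))) //; first last.
  + exact: measurable_xsection.
  + move=> t u tu; apply: indep => k; have [l ->|->//] := unliftP ord0 k.
    by rewrite ij (inj_eq lift_inj) !tnthS; exact: tu.
  + apply: (measurableT_comp mphi); apply: (measurableT_comp mc).
    exact: measurable_pair1.
  congr (lebesgue_tuple n _); apply/seteqP; split=> t.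
    by rewrite /xsection /preimage /= !inE /= ij shear_consS.
  by rewrite /xsection /preimage /= !inE /= ij shear_consS.
(* Uniqueness of the product measure reverses the order of integration, so that the sheared
   coordinate becomes the inner variable. *)
- rewrite !(@product_measure_unique _ _ _ _ _ lebesgue_measure
    (lebesgue_tuple n)
     [the {measure set _ -> \bar R} of (lebesgue_measure
       \x^ lebesgue_tuple n)%E]) //; last 2 first.
    by move=> *; rewrite /= product_measure2E.
  by move=> *; rewrite /= product_measure2E.
  rewrite /= /product_measure2; apply: eq_integral => t _ /=.
  rewrite -[RHS](@lebesgue_measure_translation (phi (tuple_cons (0, t))));
    last first.
    exact: measurable_ysection.
  congr (lebesgue_measure _); apply/seteqP.
  have phi0 x : phi (tuple_cons (x, t)) = phi (tuple_cons (0, t)).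
    apply: indep => k; rewrite i0.
    by have [l ->|->] := unliftP ord0 k; rewrite ?eqxx// !tnthS.
  split=> x.
    by rewrite /ysection /preimage /= !inE /= i0 shear_cons0 (phi0 x).
  by rewrite /ysection /preimage /= !inE /= i0 shear_cons0 (phi0 x).
Qed.

End shear.

(** * Plane rotations *)

Section rotation.
Context {R : realType}.

Definition plane_rot n (i j : 'I_n) (c s : R) (x : n.-tuple R) : n.-tuple R :=
  [tuple if l == i then c * tnth x i + s * tnth x j
         else if l == j then c * tnth x j - s * tnth x i else tnth x l | l < n].

Lemma measurable_plane_rot n (i j : 'I_n) c s :
  measurable_fun [set: n.-tuple R] (plane_rot i j c s).
Proof.
apply/measurable_fun_tnthP => l.
rewrite (_ : _ \o _ = fun x : n.-tuple R =>
    if l == i then c * tnth x i + s * tnth x j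
    else if l == j then c * tnth x j - s * tnth x i else tnth x l); last first.
  by apply/funext => x /=; rewrite tnth_mktuple.
case: (l == i).
  by apply: measurable_funD; apply: measurable_funM => //;
    exact: measurable_tnth.
case: (l == j); last exact: measurable_tnth.
by apply: measurable_funB; apply: measurable_funM => //; exact: measurable_tnth.
Qed.

(** For [c = cos t] and [s = sin t], [a] is the tangent of t / 2, and both shears along [i] use it.
    The condition [1 + c != 0] excludes the half turn. *)
Lemma plane_rot_shear n (i j : 'I_n) c s : i != j -> 1 + c != 0 ->
  c ^+ 2 + s ^+ 2 = 1 ->
  let a := s / (1 + c) in
  plane_rot i j c s = shear i (fun x => a * tnth x j) \o
    shear j (fun x => - s * tnth x i) \o shear i (fun x => a * tnth x j).
Proof.
move=> ij c1 cs a; apply/funext => x; apply: eq_from_tnth => l /=.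
have ji : (j == i) = false by rewrite eq_sym (negbTE ij).
have as_ : a * s = 1 - c.
  rewrite /a mulrAC -expr2 (_ : s ^+ 2 = (1 - c) * (1 + c)) ?mulfK//.
  by apply: (addrI (c ^+ 2)); rewrite cs; ring.
have ac : a * c = s - a.
  by apply: (addrI a); rewrite -{1}[a]mulr1 -mulrDr divfK// addrC subrK.
rewrite !tnth_mktuple; have [->|li] := eqVneq l i.
  rewrite ?tnth_mktuple ?eqxx ?ji ?(negbTE ij).
  transitivity ((1 - a * s) * tnth x i + (a + a * (1 - a * s)) * tnth x j);
    last by ring.
  by rewrite as_ subKr ac addrCA subrr addr0.
have [->|//] := eqVneq l j; rewrite ?tnth_mktuple ?eqxx ?ji ?(negbTE ij).
transitivity ((1 - a * s) * tnth x j - s * tnth x i); last by ring.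
by rewrite as_ subKr.
Qed.

Lemma lebesgue_tuple_rot n (i j : 'I_n) c s (A : set (n.-tuple R)) :
  i != j -> 1 + c != 0 -> c ^+ 2 + s ^+ 2 = 1 -> measurable A ->
  lebesgue_tuple n (plane_rot i j c s @^-1` A) = lebesgue_tuple n A.
Proof.
move=> ij c1 cs mA; rewrite plane_rot_shear// 2!comp_preimage.
have mM (k : 'I_n) (a : R) : measurable_fun [set: n.-tuple R] (fun x =>
  a * tnth x k).
  by apply: measurable_funM => //; exact: measurable_tnth.
have mP (k : 'I_n) (a : R) l B : measurable B ->
    measurable (shear k (fun x => a * tnth x l) @^-1` B).
  by move=> mB; rewrite -[X in measurable X]setTI; exact: measurable_shear.
have ji : j != i by rewrite eq_sym.
have mA2 := mP i (s / (1 + c)) j A mA.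
have mA1 := mP j (- s) i _ mA2.
by rewrite lebesgue_tuple_shear ?lebesgue_tuple_shear//; move=> x y ->.
Qed.

Lemma eucl_norm_rot n (i j : 'I_n) c s (x : n.-tuple R) :
  i != j -> c ^+ 2 + s ^+ 2 = 1 ->
    eucl_norm (plane_rot i j c s x) = eucl_norm x.
Proof.
move=> ij cs; congr (Num.sqrt _).
rewrite (bigD1 i)//= (bigD1 j) 1?eq_sym//= [RHS](bigD1 i)//= [in RHS](bigD1 j)
  1?eq_sym//=.
rewrite !addrA; congr (_ + _).
  rewrite !tnth_mktuple eqxx eq_sym (negbTE ij) eqxx.
  transitivity ((c ^+ 2 + s ^+ 2) * (tnth x i ^+ 2 + tnth x j ^+ 2));
    first by ring.
  by rewrite cs mul1r.
apply: eq_bigr => l /andP[li lj].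
by rewrite tnth_mktuple (negbTE li) (negbTE lj).
Qed.

Lemma normalize_rot n (i j : 'I_n) c s (x : n.-tuple R) :
  i != j -> c ^+ 2 + s ^+ 2 = 1 ->
  normalize (plane_rot i j c s x) = plane_rot i j c s (normalize x).
Proof.
move=> ij cs; apply: eq_from_tnth => l.
rewrite !tnth_mktuple eucl_norm_rot//.
by case: ifP => _; [ring|case: ifP => _ //; ring].
Qed.

(** A rotation preserves the norm and commutes with [normalize], hence the cone over a preimage is
    the preimage of the cone, and the invariance of Lebesgue measure carries over. *)
Lemma surface_measure_rot n (i j : 'I_n) c s (A : set (n.-tuple R)) :
  i != j -> 1 + c != 0 -> c ^+ 2 + s ^+ 2 = 1 -> measurable A ->
  surface_measure R n (plane_rot i j c s @^-1` A) = surface_measure R n A.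
Proof.
move=> ij c1 cs mA; rewrite /surface_measure
  -[in RHS](lebesgue_tuple_rot ij c1 cs); last first.
  exact: measurable_cone.
congr (_ * lebesgue_tuple n _)%E; apply/seteqP; split => x.
  by rewrite /cone /preimage /= eucl_norm_rot// normalize_rot.
by rewrite /cone /preimage /= eucl_norm_rot// normalize_rot.
Qed.

Lemma measurable_unit_sphere n : measurable (unit_sphere R n).
Proof.
rewrite (_ : unit_sphere R n = (@eucl_norm R n) @^-1` [set 1]); last first.
  by apply/seteqP; split.
by rewrite -[X in measurable X]setTI; exact: measurable_eucl_norm.
Qed.

Lemma unit_sphere_sum n (e : n.-tuple R) :
  unit_sphere R n e -> \sum_(i < n) tnth e i ^+ 2 = 1.
Proof.
rewrite /unit_sphere /= /eucl_norm => /(congr1 (fun x => x ^+ 2)).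
by rewrite sqr_sqrtr ?expr1n// sumr_ge0// => i _; rewrite sqr_ge0.
Qed.

Lemma tnth_le_eucl_norm n (x : n.-tuple R) i : `|tnth x i| <= eucl_norm x.
Proof.
rewrite -sqrtr_sqr ler_wsqrtr// (bigD1 i)//= lerDl.
by apply: sumr_ge0 => k _; rewrite sqr_ge0.
Qed.

(** Every cone lies in the cube with side [[-1, 1]], whose volume is finite by induction on the
    dimension. *)
Lemma surface_measure_lty n (A : set (n.-tuple R)) : measurable A ->
  (surface_measure R n A < +oo)%E.
Proof.
move=> mA; rewrite /surface_measure lte_mul_pinfty ?lee_fin//.
pose box n : set (n.-tuple R) :=
  \bigcap_(i in [set: 'I_n]) (fun x => tnth x i) @^-1` `[-1, 1].
have mbox m : measurable (box m).
  apply: fin_bigcap_measurable => // i _.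
  by rewrite -[X in measurable X]setTI; apply: measurable_tnth.
apply: (@le_lt_trans _ _ (lebesgue_tuple n (box n))).
  apply: le_measure; rewrite ?inE; [exact: measurable_cone|exact: mbox|].
  move=> x [/andP[_ x1] _] i _ /=; rewrite in_itv/= -ler_norml.
  exact: le_trans (tnth_le_eucl_norm _ _) x1.
elim: n {mA A} => [|n IHn] /=.
  by rewrite diracE; case: (_ \in _); rewrite ltry.
rewrite /lebesgue_cons /pushforward (_ : _ @^-1` _ = `[-1,
  1]%classic `*` box n); last first.
  apply/seteqP; split => -[x t] /=.
    move=> h; split; first exact: (h ord0 I).
    by move=> k _; have := h (lift ord0 k) I; rewrite /= tnthS.
  move=> [h1 h2] k _ /=; have [l ->|->] := unliftP ord0 k; last exact: h1.
  by rewrite tnthS; exact: h2.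
rewrite product_measure1E//; last exact: mbox.
rewrite lte_mul_pinfty//.
by rewrite /= lebesgue_measure_itv/= lte_fin; case: ifP.
Qed.

Lemma integral_surface_rot n (i j : 'I_n) c s (f : n.-tuple R -> \bar R) :
  i != j -> 1 + c != 0 -> c ^+ 2 + s ^+ 2 = 1 ->
  measurable_fun (unit_sphere R n) f -> (forall e, 0 <= f e)%E ->
  (\int[surface_measure R n]_(e in unit_sphere R n) f (plane_rot i j c s e) =
   \int[surface_measure R n]_(e in unit_sphere R n) f e)%E.
Proof.
move=> ij c1 cs mf f0.
have mr := measurable_plane_rot i j c s.
transitivity (\int[pushforward (surface_measure R n)
  (plane_rot i j c s)]_(e in unit_sphere R n) f e)%E.
  rewrite (ge0_integral_pushforward mr)//; last exact: measurable_unit_sphere.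
  congr integral; apply/seteqP; split=> x; rewrite /unit_sphere /preimage /=;
  by rewrite eucl_norm_rot.
by apply: eq_measure_integral => A mA _;
  rewrite /= /pushforward surface_measure_rot.
Qed.

End rotation.

(** * Differentiation under a bounded integral *)

Section bounded_integrals.
Context d (Y : measurableType d) (R : realType).
Variables (mu : {measure set Y -> \bar R}) (B : set Y).
Hypotheses (mB : measurable B) (Boo : (mu B < +oo)%E).

Lemma integrable_of_le (f : Y -> R) C : measurable_fun B f ->
  (forall y, B y -> `|f y| <= C) -> mu.-integrable B (EFin \o f).
Proof.
move=> mf fC; apply: measurable_bounded_integrable => //.
exists C; split; first exact: num_real.
by move=> M CM y By /=; exact: le_trans (fC _ By) (ltW CM).
Qed.

Lemma Rintegral_sum (I : Type) (r : seq I) (f : I -> Y -> R) :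
  (forall i, mu.-integrable B (EFin \o f i)) ->
  \int[mu]_(y in B) (\sum_(i <- r) f i y) = \sum_(i <- r)
    \int[mu]_(y in B) f i y.
Proof.
move=> intf; elim: r => [|i r IHr].
  under eq_Rintegral do rewrite big_nil.
  by rewrite big_nil Rintegral_cst ?mul0r.
rewrite big_cons -IHr -RintegralD//.
  by apply: eq_Rintegral => y _; rewrite big_cons.
rewrite (_ : _ \o _ = fun y => (\sum_(i <- r) (EFin \o f i) y)%E).
  exact: integrable_sum.
by apply/funext => y /=; rewrite sumEFin.
Qed.

(** Dominated differentiation with a constant bound, integrable because [mu B] is finite. *)
Lemma is_derive_Rintegral (f f1 : R -> Y -> R) (a u v C : R) :
  u < a < v ->
  (forall x, u < x < v -> measurable_fun B (f x)) ->
  (forall x y, u < x < v -> B y -> is_derive x 1 (f ^~ y) (f1 x y)) ->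
  (forall x y, u < x < v -> B y -> `|f x y| <= C) ->
  (forall x y, u < x < v -> B y -> `|f1 x y| <= C) ->
  is_derive a 1 (fun x => \int[mu]_(y in B) f x y) (\int[mu]_(y in B) f1 a y).
Proof.
move=> auv mf df fC f1C.
have Ia : `]u, v[%classic a by rewrite /= in_itv.
have intf x : `]u, v[%classic x -> mu.-integrable B (EFin \o f x).
  by rewrite /= in_itv/= => xuv;
    apply: (@integrable_of_le _ C) (mf _ xuv) _ => y; exact: fC.
have dif x y : `]u, v[%classic x -> B y -> derivable (f ^~ y) x 1.
  by rewrite /= in_itv/= => xuv By; have [] := df _ _ xuv By.
have pE x y : u < x < v -> B y -> partial1of2 f x y = f1 x y.
  by move=> xuv By; rewrite partial1of2E; have [_ ->] := df _ _ xuv By.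
(* The absolute value is taken because [C] may be negative when [B] is empty. *)
have intC : mu.-integrable B (EFin \o (fun=> `|C|)).
  by apply: (@integrable_of_le _ `|C|) => // y _; rewrite normr_id.
have C0 (y : Y) : 0 <= `|C| by [].
have bd x y : `]u, v[%classic x -> B y -> `|partial1of2 f x y| <= `|C|.
  rewrite /= in_itv/= => xuv By; rewrite pE//.
  by rewrite (le_trans (f1C _ _ xuv By))// ler_norm.
apply: DeriveDef.
  exact: (derivable_under_integral mB Ia intf dif C0 intC bd).
rewrite -derive1E (differentiation_under_integral mB Ia intf dif C0 intC bd).
by apply: eq_Rintegral => y; rewrite inE => By; rewrite pE.
Qed.

(** A constant function of the parameter has zero second derivative, and both derivatives pass under
    the integral sign. The parameter will be an angle of rotation. *)
Lemma Rintegral_derive2_eq0 (f f1 f2 : R -> Y -> R) (r C : R) :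
  0 < r ->
  (forall x, - r < x < r -> measurable_fun B (f x)) ->
  (forall x, - r < x < r -> measurable_fun B (f1 x)) ->
  (forall x y, - r < x < r -> B y -> is_derive x 1 (f ^~ y) (f1 x y)) ->
  (forall x y, - r < x < r -> B y -> is_derive x 1 (f1 ^~ y) (f2 x y)) ->
  (forall x y, - r < x < r -> B y -> `|f x y| <= C) ->
  (forall x y, - r < x < r -> B y -> `|f1 x y| <= C) ->
  (forall x y, - r < x < r -> B y -> `|f2 x y| <= C) ->
  (forall x, - r < x < r ->
    \int[mu]_(y in B) f x y = \int[mu]_(y in B) f 0 y) ->
  \int[mu]_(y in B) f2 0 y = 0.
Proof.
move=> r0 mf mf1 df df1 fC f1C f2C cstf.
have near_r (x : R) : - r < x < r -> \forall y \near x, - r < y < r.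
  move=> xr; have := @near_in_itvoo _ (- r) r x.
  rewrite in_itv/= => /(_ xr); apply: filterS => y.
  by rewrite in_itv.
have zr : - r < 0 < r by rewrite oppr_lt0 r0.
have F1 x : - r < x < r -> \int[mu]_(y in B) f1 x y = 0.
  move=> xr; have [_ <-] := is_derive_Rintegral xr mf df fC f1C.
  rewrite (near_eq_derive (g := cst (\int[mu]_(y in B) f 0 y))) ?derive_cst//.
  by apply: filterS (near_r _ xr) => y; exact: cstf.
have [_ <-] := is_derive_Rintegral zr mf1 df1 f1C f2C.
rewrite (near_eq_derive (g := cst 0)) ?derive_cst//.
by apply: filterS (near_r _ zr) => y; exact: F1.
Qed.

End bounded_integrals.

(** * Negative powers of quadratic polynomials *)

Section scalar_derivatives.
Context {R : realType}.
Implicit Types f g : R -> R.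

Lemma is_derive_addf f g (x df dg : R) : is_derive x 1 f df ->
  is_derive x 1 g dg ->
  is_derive x 1 (fun t => f t + g t) (df + dg).
Proof. exact: is_deriveD. Qed.

Lemma is_derive_mulf f g (x df dg : R) : is_derive x 1 f df ->
  is_derive x 1 g dg ->
  is_derive x 1 (fun t => f t * g t) (df * g x + f x * dg).
Proof.
move=> hf hg; apply: is_derive_eq (is_deriveM hf hg) _.
by rewrite addrC; congr (_ + _); exact: mulrC.
Qed.

Lemma is_derive_mulcf f (c x df : R) : is_derive x 1 f df ->
  is_derive x 1 (fun t => c * f t) (c * df).
Proof. by move=> hf; apply: is_derive_eq (is_deriveZ c hf) _. Qed.

Lemma is_derive_sumf n (f : R -> 'I_n -> R) (x : R) (df : 'I_n -> R) :
  (forall i, is_derive x 1 (f ^~ i) (df i)) ->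
  is_derive x 1 (fun t => \sum_i f t i) (\sum_i df i).
Proof.
move=> h; have := is_derive_sum h; rewrite fct_sumE.
exact.
Qed.

Lemma is_derive_powRf f (a x df : R) : 0 < f x -> is_derive x 1 f df ->
  is_derive x 1 (fun t => f t `^ a) (a * f x `^ (a - 1) * df).
Proof. by move=> fx0 hf;
  have := is_derive1_comp (is_derive1_powR a fx0) hf. Qed.

End scalar_derivatives.

Section quadratic.
Context {R : realType}.
Variables (n : nat) (c : R) (b : 'I_n -> R) (A : 'I_n -> 'I_n -> R).
Hypothesis symA : forall i j, A i j = A j i.
Implicit Types v w z : 'I_n -> R.

Definition quad v := c + 2 * (\sum_i b i * v i) + \sum_i \sum_j A i j *
  (v i * v j).

(** Half the gradient of [quad], since [A] is symmetric. *)
Definition hgrad v i := b i + \sum_j A i j * v j.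

Definition dquad v w := 2 * \sum_i hgrad v i * w i.

(** Second derivative of [quad] along a curve through [v] with velocity [w] and acceleration [z].
    Straight lines do not suffice, as rotated points move on circles. *)
Definition d2quad v w z := 2 * (\sum_i \sum_j A i j * (w i * w j)) + dquad v z.

Lemma is_derive_quad (g : R -> 'I_n -> R) (x : R) w :
  (forall i, is_derive x 1 (g ^~ i) (w i)) ->
  is_derive x 1 (fun t => quad (g t)) (dquad (g x) w).
Proof.
move=> hg; rewrite /quad.
have h1 : is_derive x 1 (fun t =>
  c + 2 * \sum_i b i * g t i) (0 + 2 * \sum_i b i * w i).
  apply: is_derive_addf.
  by apply: is_derive_mulcf; apply: is_derive_sumf => i; exact: is_derive_mulcf.
have h2 : is_derive x 1 (fun t => \sum_i \sum_j A i j * (g t i * g t j))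
    (\sum_i \sum_j A i j * (w i * g x j + g x i * w j)).
  apply: is_derive_sumf => i; apply: is_derive_sumf => j.
  by apply: is_derive_mulcf; exact: is_derive_mulf.
apply: is_derive_eq (is_derive_addf h1 h2) _.
rewrite add0r /dquad /hgrad; under [in RHS]eq_bigr do rewrite mulrDl.
rewrite big_split /= mulrDr; congr (_ + _).
under eq_bigr => i _ do under eq_bigr => j _ do rewrite mulrDr.
under eq_bigr do rewrite big_split /=.
rewrite big_split /= [X in _ + X]exchange_big /= mulr2n.
rewrite [in RHS]mulrDl !mul1r; congr (_ + _); apply: eq_bigr => i _;
  rewrite mulr_suml;
  apply: eq_bigr => j _; first by rewrite mulrA mulrAC.
by rewrite symA mulrA.
Qed.

Lemma is_derive_dquad (g w : R -> 'I_n -> R) (x : R) z :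
  (forall i, is_derive x 1 (g ^~ i) (w x i)) ->
  (forall i, is_derive x 1 (w ^~ i) (z i)) ->
  is_derive x 1 (fun t => dquad (g t) (w t)) (d2quad (g x) (w x) z).
Proof.
move=> hg hw; rewrite /dquad /d2quad.
have h1 i : is_derive x 1 (fun t => hgrad (g t) i) (0 + \sum_j A i j * w x j).
  apply: is_derive_addf.
  by apply: is_derive_sumf => j; exact: is_derive_mulcf.
have h2 : is_derive x 1 (fun t => 2 * \sum_i hgrad (g t) i * w t i)
   (2 * \sum_i ((0 + \sum_j A i j * w x j) * w x i + hgrad (g x) i * z i)).
  by apply: is_derive_mulcf; apply: is_derive_sumf => i; exact: is_derive_mulf.
apply: is_derive_eq h2 _.
rewrite big_split /= mulrDr; congr (2 * _ + _); apply: eq_bigr => i _.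
by rewrite add0r mulr_suml; apply: eq_bigr => j _;
  rewrite -mulrA [w x j * _]mulrC.
Qed.

Variable k : R.

Definition qpow v := quad v `^ (- k).

Definition dqpow v w := - k * quad v `^ (- k - 1) * dquad v w.

(** As in [d2quad], [w] and [z] are the velocity and the acceleration of a curve through [v]. *)
Definition d2qpow v w z :=
  - k * ((- k - 1) * quad v `^ (- k - 1 - 1) * dquad v w ^+ 2 +
         quad v `^ (- k - 1) * d2quad v w z).

Variable m : R.
Hypotheses (m0 : 0 < m) (quad_ge : forall v, m <= quad v).

Let quad_gt0 v : 0 < quad v. Proof. exact: lt_le_trans m0 (quad_ge v). Qed.

Lemma is_derive_qpow (g : R -> 'I_n -> R) (x : R) w :
  (forall i, is_derive x 1 (g ^~ i) (w i)) ->
  is_derive x 1 (fun t => qpow (g t)) (dqpow (g x) w).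
Proof. by move=> hg; apply: is_derive_powRf => //; exact: is_derive_quad. Qed.

Lemma is_derive_dqpow (g w : R -> 'I_n -> R) (x : R) z :
  (forall i, is_derive x 1 (g ^~ i) (w x i)) ->
  (forall i, is_derive x 1 (w ^~ i) (z i)) ->
  is_derive x 1 (fun t => dqpow (g t) (w t)) (d2qpow (g x) (w x) z).
Proof.
move=> hg hw; rewrite /dqpow /d2qpow.
have h1 := @is_derive_powRf _ (fun t =>
  quad (g t)) (- k - 1) x _ (quad_gt0 (g x)) (is_derive_quad hg).
have h2 := is_derive_mulf (is_derive_mulcf (- k) h1) (is_derive_dquad hg hw).
by apply: is_derive_eq h2 _; ring.
Qed.

Lemma norm_sum_le (f : 'I_n -> R) C : (forall i, `|f i| <= C) ->
  `|\sum_i f i| <= n%:R * C.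
Proof.
move=> fC; apply: (le_trans (ler_norm_sum _ _ _)).
rewrite -[n in n%:R]card_ord -sum1_card natr_sum mulr_suml.
by apply: ler_sum => i _; rewrite mul1r.
Qed.

Hypothesis k0 : 0 <= k.

Lemma powR_quad_le v a : a <= 0 -> `|quad v `^ a| <= m `^ a.
Proof.
move=> a0; rewrite ger0_norm ?powR_ge0//.
have na : 0 <= - a by rewrite oppr_ge0.
have E x : x `^ a = (x `^ (- a))^-1 by rewrite -powRN opprK.
rewrite !E lef_pV2 ?posrE ?powR_gt0//.
by apply: (ge0_ler_powR na); rewrite ?nnegrE ?(ltW m0) ?(ltW (quad_gt0 v)).
Qed.

(** The lower bound [m] on [quad] controls the negative powers, and [M] controls the polynomial
    factors. A single constant for the three quantities can serve as the dominating constant under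
    the integral. *)
Lemma qpow_bounded M : 0 <= M -> exists C, forall v w z,
  (forall i, `|v i| <= M) -> (forall i, `|w i| <= M) -> (forall i, `|z i| <=
    M) ->
  [/\ `|qpow v| <= C, `|dqpow v w| <= C & `|d2qpow v w z| <= C].
Proof.
move=> M0.
pose bb := \sum_i `|b i|; pose AA := \sum_i \sum_j `|A i j|.
have bb0 : 0 <= bb by apply: sumr_ge0.
have AA0 : 0 <= AA by apply: sumr_ge0 => i _; apply: sumr_ge0.
have bE i : `|b i| <= bb by rewrite /bb (bigD1 i)//= lerDl sumr_ge0.
have AE i j : `|A i j| <= AA.
  rewrite /AA (bigD1 i)//= (bigD1 j)//= -addrA lerDl addr_ge0 ?sumr_ge0//.
  by move=> l _; apply: sumr_ge0.
(* [Cg], [D] and [D2] bound [hgrad], [dquad] and [d2quad] on vectors whose entries are at most [M]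
   in absolute value. *)
pose Cg := bb + n%:R * (AA * M).
pose D := 2 * (n%:R * (Cg * M)).
pose D2 := 2 * (n%:R * (n%:R * (AA * (M * M)))) + D.
have Cg0 : 0 <= Cg by rewrite addr_ge0// !mulr_ge0.
have D0 : 0 <= D by rewrite !mulr_ge0.
have D20 : 0 <= D2 by rewrite addr_ge0// !mulr_ge0.
pose C1 := k * m `^ (- k - 1) * D.
pose C2 := k * ((k + 1) * m `^ (- k - 1 - 1) * D ^+ 2 + m `^ (- k - 1) * D2).
exists (m `^ (- k) + C1 + C2) => v w z vM wM zM.
have C10 : 0 <= C1 by rewrite !mulr_ge0// powR_ge0.
have C20 : 0 <= C2.
  have k10 : 0 <= k + 1 by rewrite addr_ge0.
  apply: mulr_ge0 => //; apply: addr_ge0; last by rewrite mulr_ge0 ?powR_ge0.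
  by rewrite mulr_ge0 ?exprn_ge0// mulr_ge0 ?powR_ge0.
have gC i : `|hgrad v i| <= Cg.
  apply: (le_trans (ler_normD _ _)); apply: lerD => //.
  by apply: norm_sum_le => j; rewrite normrM ler_pM.
have dC u : (forall i, `|u i| <= M) -> `|dquad v u| <= D.
  move=> uM; rewrite normrM ger0_norm// ler_pM2l//.
  by apply: norm_sum_le => i; rewrite normrM ler_pM.
have d2C : `|d2quad v w z| <= D2.
  apply: (le_trans (ler_normD _ _)); apply: lerD; last exact: dC.
  rewrite normrM ger0_norm// ler_pM2l//.
  apply: norm_sum_le => i; apply: norm_sum_le => j.
  by rewrite !normrM !ler_pM ?mulr_ge0.
have k1 : - k - 1 <= 0 by rewrite -opprD oppr_le0 addr_ge0.
have k2 : - k - 1 - 1 <= 0 by rewrite -!opprD oppr_le0 !addr_ge0.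
split.
- apply: (@le_trans _ _ (m `^ (- k))); last by rewrite -addrA lerDl addr_ge0.
  by apply: powR_quad_le; rewrite oppr_le0.
- apply: (@le_trans _ _ C1);
    last by rewrite -addrA addrCA lerDl addr_ge0 ?powR_ge0.
  rewrite 2!normrM normrN (ger0_norm k0) /C1.
  apply: ler_pM => //; [by rewrite mulr_ge0| |exact: dC].
  by apply: ler_wpM2l => //; exact: powR_quad_le.
- apply: (@le_trans _ _ C2); last by rewrite lerDr addr_ge0 ?powR_ge0.
  rewrite normrM normrN (ger0_norm k0) /C2 ler_wpM2l//.
  apply: (le_trans (ler_normD _ _)); apply: lerD.
    rewrite 2!normrM normrX; apply: ler_pM => //.
    + apply: ler_pM => //; last exact: powR_quad_le.
      by rewrite -opprD normrN ger0_norm ?addr_ge0.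
    + by rewrite lerXn2r ?nnegrE// dC.
  by rewrite normrM; apply: ler_pM => //; exact: powR_quad_le.
Qed.

Section measurability.
Context d (Y : measurableType d) (D : set Y).

Lemma measurable_quad (v : Y -> 'I_n -> R) :
  (forall i, measurable_fun D (v ^~ i)) -> measurable_fun D (fun y =>
    quad (v y)).
Proof.
move=> mv; apply: measurable_funD; first apply: measurable_funD => //.
  apply: measurable_funM => //; apply: measurable_sum => i.
  by apply: measurable_funM.
by do 2![apply: measurable_sum => ?]; do 2!apply: measurable_funM => //.
Qed.

Lemma measurable_dquad (v w : Y -> 'I_n -> R) :
  (forall i, measurable_fun D (v ^~ i)) -> (forall i,
    measurable_fun D (w ^~ i)) ->
  measurable_fun D (fun y => dquad (v y) (w y)).
Proof.
move=> mv mw; apply: measurable_funM => //; apply: measurable_sum => i.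
apply: measurable_funM => //; apply: measurable_funD => //.
by apply: measurable_sum => j; exact: measurable_funM.
Qed.

Lemma measurable_qpow (v : Y -> 'I_n -> R) :
  (forall i, measurable_fun D (v ^~ i)) -> measurable_fun D (fun y =>
    qpow (v y)).
Proof.
move=> mv; apply: (measurableT_comp (measurable_powR _));
  exact: measurable_quad.
Qed.

Lemma measurable_dqpow (v w : Y -> 'I_n -> R) :
  (forall i, measurable_fun D (v ^~ i)) -> (forall i,
    measurable_fun D (w ^~ i)) ->
  measurable_fun D (fun y => dqpow (v y) (w y)).
Proof.
move=> mv mw; apply: measurable_funM; last exact: measurable_dquad.
apply: measurable_funM => //; apply: (measurableT_comp (measurable_powR _)).
exact: measurable_quad.
Qed.

Lemma measurable_d2qpow (v w z : Y -> 'I_n -> R) :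
  (forall i, measurable_fun D (v ^~ i)) -> (forall i,
    measurable_fun D (w ^~ i)) ->
  (forall i, measurable_fun D (z ^~ i)) ->
  measurable_fun D (fun y => d2qpow (v y) (w y) (z y)).
Proof.
move=> mv mw mz; apply: measurable_funM => //; apply: measurable_funD.
  apply: measurable_funM; last by apply: measurable_funX;
    exact: measurable_dquad.
  apply: measurable_funM => //; apply: (measurableT_comp (measurable_powR _)).
  exact: measurable_quad.
apply: measurable_funM.
  by apply: (measurableT_comp (measurable_powR _)); exact: measurable_quad.
apply: measurable_funD; last exact: measurable_dquad.
apply: measurable_funM => //.
by do 2![apply: measurable_sum => ?]; do 2!apply: measurable_funM => //.
Qed.

End measurability.
End quadratic.

(** * Sums over the generators of plane rotations *)

Section plane_rotation_generators.
Context {R : comPzRingType} {n : nat}.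
Implicit Types (e g : 'I_n -> R) (i j l : 'I_n).

(** For [i != j], the velocity at t = 0 of [plane_rot i j (cos t) (sin t) e]. It vanishes for
    [i = j], so that sums may run over all ordered pairs. *)
Definition rot_gen i j e l : R := (l == i)%:R * e j - (l == j)%:R * e i.

Lemma sum_rot_gen i j e g :
  \sum_l g l * rot_gen i j e l = g i * e j - g j * e i.
Proof.
under eq_bigr do rewrite mulrBr.
rewrite sumrB; congr (_ - _).
  rewrite (bigD1 i)//= eqxx mul1r big1 ?addr0// => l /negbTE->.
  by rewrite mul0r mulr0.
rewrite (bigD1 j)//= eqxx mul1r big1 ?addr0// => l /negbTE->.
by rewrite mul0r mulr0.
Qed.

(** Lagrange's identity, each unordered pair being counted twice. *)
Lemma sum_rot_gen_sqr e g :
  \sum_i \sum_j (\sum_l g l * rot_gen i j e l) ^+ 2 =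
  2 * ((\sum_i g i ^+ 2) * (\sum_i e i ^+ 2) - (\sum_i g i * e i) ^+ 2).
Proof.
have E i j : (\sum_l g l * rot_gen i j e l) ^+ 2 =
    g i ^+ 2 * e j ^+ 2 + e i ^+ 2 * g j ^+ 2 - 2 * (g i * e i) * (g j * e j).
  by rewrite sum_rot_gen; ring.
under eq_bigr do under eq_bigr do rewrite E.
under eq_bigr do rewrite sumrB big_split /= -!mulr_sumr.
by rewrite sumrB big_split /= -!mulr_suml -mulr_sumr; ring.
Qed.

(** The form of [A] at the generator is A_ii e_j^2 + A_jj e_i^2 - 2 A_ij e_i e_j, which is then
    summed over all pairs. *)
Lemma sum_rot_gen_quad e (A : 'I_n -> 'I_n -> R) : (forall i j,
  A i j = A j i) ->
  \sum_i \sum_j \sum_l \sum_m A l m * (rot_gen i j e l * rot_gen i j e m) =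
  2 * ((\sum_i A i i) * (\sum_i e i ^+ 2) - \sum_i \sum_j A i j * (e i * e j)).
Proof.
move=> symA.
have E i j : \sum_l \sum_m A l m * (rot_gen i j e l * rot_gen i j e m) =
    A i i * e j ^+ 2 + e i ^+ 2 * A j j - 2 * (A i j * (e i * e j)).
  transitivity (\sum_l (A l i * e j - A l j * e i) * rot_gen i j e l).
    apply: eq_bigr => l _; rewrite -sum_rot_gen mulr_suml.
    by apply: eq_bigr => m _; ring.
  by rewrite sum_rot_gen (symA j i); ring.
under eq_bigr do under eq_bigr do rewrite E.
under eq_bigr do rewrite sumrB big_split /= -!mulr_sumr.
by rewrite sumrB big_split /= -!mulr_suml -mulr_sumr; ring.
Qed.

(** For [i != j], applying the generator twice projects onto the plane of [i] and [j] and changes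
    the sign. Each coordinate belongs to 2 (n - 1) ordered pairs of distinct indices. *)
Lemma sum_rot_gen2 e g :
  \sum_i \sum_j \sum_l g l * rot_gen i j (rot_gen i j e) l =
  - (2 * (n%:R - 1) * \sum_i g i * e i).
Proof.
(* The first term on the right cancels the second on the diagonal, where the generator is zero. *)
have E i j : \sum_l g l * rot_gen i j (rot_gen i j e) l =
    (i == j)%:R * (2 * (g i * e i)) - (g i * e i + g j * e j).
  rewrite sum_rot_gen /rot_gen !eqxx (eq_sym j i).
  by case: eqVneq => [->|_] /=; ring.
under eq_bigr do under eq_bigr do rewrite E.
have D i : \sum_j (i == j)%:R * (2 * (g i * e i)) = 2 * (g i * e i).
  by rewrite -mulr_suml (bigD1 i)//= eqxx big1 ?addr0 ?mul1r// => j /negbTE;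
    rewrite eq_sym => ->.
have F i : \sum_j ((i == j)%:R * (2 * (g i * e i)) - (g i * e i + g j * e j)) =
    (2 - n%:R) * (g i * e i) - \sum_j g j * e j.
  rewrite sumrB D big_split /= sumr_const card_ord -mulr_natl.
  by set S := bigop _ _ _; ring.
under eq_bigr do rewrite F.
rewrite sumrB -mulr_sumr sumr_const card_ord -mulr_natl.
by set S := bigop _ _ _; ring.
Qed.

End plane_rotation_generators.

(** * Mean value inequality for a power of a quadratic polynomial *)

Section sphere_mean_of_quadratic_power.
Context {R : realType}.
Variables (n : nat) (c : R) (b : 'I_n -> R) (A : 'I_n -> 'I_n -> R) (k m : R).
Hypothesis symA : forall i j, A i j = A j i.
Hypotheses (k0 : 0 <= k) (m0 : 0 < m) (quad_ge : forall v, m <= quad c b A v).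
Implicit Types v w z : 'I_n -> R.

Local Notation q := (quad c b A).
Local Notation f := (qpow c b A k).
Local Notation df := (dqpow c b A k).
Local Notation d2f := (d2qpow c b A k).
Local Notation S := (unit_sphere R n).
Local Notation sigma := (surface_measure R n).

(** The Laplacian of [qpow]: the gradient of [quad] is twice [hgrad], and its Laplacian is twice the
    trace of [A]. *)
Definition qpow_laplacian v :=
  - k * ((- k - 1) * q v `^ (- k - 1 - 1) * (4 * \sum_i hgrad b A v i ^+ 2) +
         q v `^ (- k - 1) * (2 * \sum_i A i i)).

(* The double sum runs over ordered pairs, so that half of it is the spherical
   Laplacian. *)
Lemma qpow_radial (s : R) (e : 'I_n -> R) : \sum_i e i ^+ 2 = 1 ->
  let v := fun l => s * e l in
  s ^+ 2 * d2f v e (cst 0) + (n%:R - 1) * s * df v e =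
  s ^+ 2 * qpow_laplacian v - 2^-1 * \sum_i \sum_j
    d2f v (fun l => s * rot_gen i j e l) (fun l =>
      s * rot_gen i j (rot_gen i j e) l).
Proof.
move=> e1 v.
pose g := hgrad b A v; pose Q1 := q v `^ (- k - 1);
  pose Q2 := q v `^ (- k - 1 - 1).
have dqE w : dquad b A v w = 2 * \sum_i g i * w i by [].
have dqZ w : dquad b A v (fun l => s * w l) = s * (2 * \sum_i g i * w i).
  rewrite dqE [RHS]mulrCA; congr (2 * _); rewrite mulr_sumr;
    apply: eq_bigr => i _; exact: mulrCA.
have qZ w : \sum_i \sum_j A i j * ((s * w i) * (s * w j)) =
    s ^+ 2 * \sum_i \sum_j A i j * (w i * w j).
  by rewrite mulr_sumr; apply: eq_bigr => i _; rewrite mulr_sumr;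
    apply: eq_bigr => j _; ring.
pose a i j := (\sum_l g l * rot_gen i j e l) ^+ 2.
pose bb i j := \sum_l \sum_m A l m * (rot_gen i j e l * rot_gen i j e m).
pose cc i j := \sum_l g l * rot_gen i j (rot_gen i j e) l.
(* [x], [y] and [z] are the coefficients of the squared velocity term, of the Hessian term and of
   the acceleration term. *)
pose x := - k * ((- k - 1) * Q2 * (4 * s ^+ 2)).
pose y := - k * (Q1 * (2 * s ^+ 2)).
pose z := - k * (Q1 * (2 * s)).
have E i j : d2f v (fun l => s * rot_gen i j e l)
    (fun l => s * rot_gen i j
      (rot_gen i j e) l) = x * a i j + y * bb i j + z * cc i j.
  by rewrite /d2qpow /d2quad !dqZ qZ -/Q1 -/Q2 -/(bb i j)
    -/(cc i j) /a /x /y /z; ring.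
under [in RHS]eq_bigr do under eq_bigr do rewrite E.
under [in RHS]eq_bigr do rewrite 2!big_split /= -!mulr_sumr.
rewrite 2!big_split /= -!mulr_sumr sum_rot_gen_sqr
  (sum_rot_gen_quad _ symA) sum_rot_gen2 e1.
rewrite /d2qpow /dqpow /d2quad /qpow_laplacian !dqE.
rewrite (_ : \sum_i g i * cst 0 i = 0); last by apply: big1 => i _;
  rewrite /= mulr0.
rewrite -/Q1 -/Q2 -/g /x /y /z.
set G := \sum_i g i ^+ 2; set T := \sum_i g i * e i.
set U := \sum_i A i i; set V := \sum_i \sum_j _; set N : R := n%:R.
have h2 : (2 : R) != 0 by [].
by field.
Qed.

(** With q the value of [quad], q^(-k-2) factors out, and the Laplacian is -2 k q^(-k-2) times the
    difference of the two sides of the hypothesis. *)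
Lemma qpow_laplacian_le0 v :
  2 * (k + 1) * (\sum_i hgrad b A v i ^+ 2) <= q v * \sum_i A i i ->
  qpow_laplacian v <= 0.
Proof.
move=> h; rewrite /qpow_laplacian.
have qv : 0 < q v := lt_le_trans m0 (quad_ge v).
have -> : q v `^ (- k - 1) = q v `^ (- k - 1 - 1) * q v.
  rewrite -[X in _ * X](powRr1 (ltW qv)) -powRD ?subrK//.
  by apply/implyP => _; rewrite (gt_eqF qv).
set Q := _ `^ _; set G := \sum_i _ in h *; set U := \sum_i _ in h *.
have -> : - k * ((- k - 1) * Q * (4 * G) + Q * q v * (2 * U)) =
  - (2 * (k * Q * (q v * U - 2 * (k + 1) * G))) by ring.
by rewrite oppr_le0 !mulr_ge0 ?powR_ge0// subr_ge0.
Qed.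

Let mS : measurable S := @measurable_unit_sphere R n.
Let Soo : (sigma S < +oo)%E := surface_measure_lty mS.

Let measurable_coord (s : R) i : measurable_fun S (fun e => s * tnth e i).
Proof. by apply: measurable_funM => //; apply: measurable_funTS;
  exact: measurable_tnth. Qed.

Let tnth_le1 e i : S e -> `|tnth e i| <= 1.
Proof. by move=> <-; exact: tnth_le_eucl_norm. Qed.

(** The integral of [f] over the sphere of radius [s] does not change when the points are rotated by
    an angle t; the integrand here is the second derivative in t at t = 0. *)
Lemma integral_d2qpow_rot_gen (s : R) (i j : 'I_n) : i != j ->
  \int[sigma]_(e in S) d2f (fun l => s * tnth e l)
    (fun l => s * rot_gen i j (tnth e) l)
    (fun l => s * rot_gen i j (rot_gen i j (tnth e)) l) = 0 :> R.
Proof.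
move=> ij.
(* [g], [g1] and [g2] are the position, velocity and acceleration at time t of the point [s] e
   rotated in the plane of [i] and [j]. *)
pose g (t : R) (e : n.-tuple R) l :=
  s * tnth (plane_rot i j (cos t) (sin t) e) l.
pose g1 (t : R) (e : n.-tuple R) l := s *
  (if l == i then - sin t * tnth e i + cos t * tnth e j
   else if l == j then - sin t * tnth e j - cos t * tnth e i else 0).
pose g2 (t : R) (e : n.-tuple R) l := s *
  (if l == i then - cos t * tnth e i - sin t * tnth e j
   else if l == j then - cos t * tnth e j + sin t * tnth e i else 0).
have dtrig (a b' t : R) (h : R -> R) (dh : R) : (forall u,
  h u = a * cos u + b' * sin u) ->
    dh = a * - sin t + b' * cos t -> is_derive t 1 h dh.
  move=> /funext -> ->.
  apply: is_derive_addf; apply: is_derive_mulcf.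
have dg (t : R) e (l : 'I_n) : is_derive t 1 (fun u => g u e l) (g1 t e l).
  rewrite /g; apply: is_derive_mulcf.
  under eq_fun do rewrite tnth_mktuple.
  case: (l == i); last case: (l == j).
  - by apply: (dtrig (tnth e i) (tnth e j)) => [u|]; ring.
  - by apply: (dtrig (tnth e j) (- tnth e i)) => [u|]; ring.
  - exact: is_derive_cst.
have dg1 (t : R) e (l : 'I_n) : is_derive t 1 (fun u => g1 u e l) (g2 t e l).
  rewrite /g1; apply: is_derive_mulcf.
  case: (l == i); last case: (l == j).
  - by apply: (dtrig (tnth e j) (- tnth e i)) => [u|]; ring.
  - by apply: (dtrig (- tnth e i) (- tnth e j)) => [u|]; ring.
  - exact: is_derive_cst.
have sc (a b' x y : R) : `|a| <= 1 -> `|b'| <= 1 -> `|x| <= 1 -> `|y| <= 1 ->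
    `|s * (a * x + b' * y)| <= `|s| * 2.
  move=> a1 b1 x1 y1; rewrite normrM ler_wpM2l//.
  rewrite (le_trans (ler_normD _ _))// (_ : 2 = 1 * 1 + 1 * 1); last by ring.
  by rewrite !normrM; apply: lerD; apply: ler_pM.
have c1 t : `|cos t : R| <= 1 by rewrite ler_norml cos_geN1 cos_le1.
have s1 t : `|sin t : R| <= 1 by rewrite ler_norml sin_geN1 sin_le1.
have gM t e (l : 'I_n) : S e -> `|g t e l| <= `|s| * 2.
  move=> Se; have e1 l' := tnth_le1 l' Se; rewrite /g tnth_mktuple.
  case: (l == i); first exact: sc.
  case: (l == j); first by rewrite -mulNr; apply: sc; rewrite ?normrN.
  by have := @sc 1 0 (tnth e l) 0; rewrite mul1r mul0r addr0 normr0 normr1;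
    apply.
have g1M t e (l : 'I_n) : S e -> `|g1 t e l| <= `|s| * 2.
  move=> Se; have e1 l' := tnth_le1 l' Se; rewrite /g1.
  case: (l == i); first by apply: sc; rewrite ?normrN.
  case: (l == j); first by rewrite -[_ - _ * _]/(_ + - _) -[-
    (cos t * _)]mulNr; apply: sc; rewrite ?normrN.
  by rewrite mulr0 normr0 mulr_ge0.
have g2M t e (l : 'I_n) : S e -> `|g2 t e l| <= `|s| * 2.
  move=> Se; have e1 l' := tnth_le1 l' Se; rewrite /g2.
  case: (l == i); first by rewrite -[- (sin t * _)]mulNr; apply: sc;
    rewrite ?normrN.
  case: (l == j); first by apply: sc; rewrite ?normrN.
  by rewrite mulr0 normr0 mulr_ge0.
have [C bC] := qpow_bounded m0 quad_ge k0 (mulr_ge0 (normr_ge0 s) (ler0n R 2)).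
have mg t (l : 'I_n) : measurable_fun S (g t ^~ l).
  apply: measurable_funM => //; apply: measurable_funTS.
  apply: (measurableT_comp (measurable_tnth _)); exact: measurable_plane_rot.
have mt (l : 'I_n) : measurable_fun S (fun e : n.-tuple R => tnth e l).
  by apply: measurable_funTS; exact: measurable_tnth.
have mg1 t (l : 'I_n) : measurable_fun S (g1 t ^~ l).
  apply: measurable_funM => //; case: (l == i); last case: (l == j) => //.
    by apply: measurable_funD; apply: measurable_funM.
  by apply: measurable_funB; apply: measurable_funM.
have g0 e : g 0 e = (fun l => s * tnth e l).
  apply/funext => l; rewrite /g cos0 sin0 tnth_mktuple; congr (_ * _).
  by case: eqVneq => [->|_]; [ring|case: eqVneq => [->|_] //; ring].
have g10 e : g1 0 e = (fun l => s * rot_gen i j (tnth e) l).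
  apply/funext => l; rewrite /g1 /rot_gen cos0 sin0; congr (_ * _).
  have [->|_] := eqVneq l i; first by rewrite (negbTE ij) /=; ring.
  by case: eqVneq => _ /=; ring.
have g20 e : g2 0 e = (fun l => s * rot_gen i j (rot_gen i j (tnth e)) l).
  apply/funext => l.
  rewrite /g2 /rot_gen !eqxx (negbTE ij) (eq_sym j i) (negbTE ij) cos0 sin0;
    congr (_ * _).
  have [->|_] := eqVneq l i; first by rewrite (negbTE ij) /=; ring.
  by case: eqVneq => _ /=; ring.
under eq_Rintegral do rewrite -g20 -g10 -g0.
(* Angles stay in the interval from - pi / 2 to pi / 2, where the cosine is positive and the
   factorization into shears applies. *)
have ph : 0 < pi / 2 :> R by rewrite divr_gt0 ?pi_gt0.
apply: (@Rintegral_derive2_eq0 _ _ _ sigma S mS Soo (fun t e => f (g t e))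
  (fun t e => df (g t e) (g1 t e)) (fun t e =>
    d2f (g t e) (g1 t e) (g2 t e)) _ C ph).
- by move=> t _; exact: measurable_qpow.
- by move=> t _; exact: measurable_dqpow.
- by move=> t e _ _; apply: (is_derive_qpow symA k m0 quad_ge) => l; exact: dg.
- by move=> t e _ _; apply: (is_derive_dqpow symA k m0 quad_ge (g :=
    g ^~ e) (w := g1 ^~ e)).
- by move=> t e _ Se; have [] := bC (g t e) (g1 t e) (g2 t e); auto.
- by move=> t e _ Se; have [] := bC (g t e) (g1 t e) (g2 t e); auto.
- by move=> t e _ Se; have [] := bC (g t e) (g1 t e) (g2 t e); auto.
move=> t tph.
have ct : 1 + cos t != 0 by rewrite gt_eqF// addr_gt0// cos_gt0_pihalf.
have cs : cos t ^+ 2 + sin t ^+ 2 = 1 by rewrite cos2Dsin2.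
have ct0 : 1 + cos 0 != 0 :> R by rewrite cos0 gt_eqF// addr_gt0.
have cs0 : cos 0 ^+ 2 + sin 0 ^+ 2 = 1 :> R by rewrite cos2Dsin2.
pose F (e : n.-tuple R) := (f (fun l => s * tnth e l))%:E.
have mF : measurable_fun S F by apply/measurable_EFinP; exact: measurable_qpow.
have F0 e : (0 <= F e)%E by rewrite lee_fin powR_ge0.
have E : (\int[sigma]_(e in S) F (plane_rot i j (cos t) (sin t) e) =
    \int[sigma]_(e in S) F (plane_rot i j (cos 0) (sin 0) e))%E.
  by rewrite !integral_surface_rot.
exact: (congr1 fine E).
Qed.

Hypothesis superh : forall v,
  2 * (k + 1) * (\sum_i hgrad b A v i ^+ 2) <= q v * \sum_i A i i.

Let mtnth i : measurable_fun S (fun e : n.-tuple R => tnth e i).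
Proof. by apply: measurable_funTS; exact: measurable_tnth. Qed.

Let rot_gen_le (C : R) (e : 'I_n -> R) i j : (forall l, `|e l| <= C) ->
  forall l, `|rot_gen i j e l| <= C * 2.
Proof.
move=> eC l; have C0 : 0 <= C := le_trans (normr_ge0 _) (eC l).
rewrite /rot_gen (le_trans (ler_normB _ _))// mulr_natr mulr2n.
by rewrite !normrM !normr_nat lerD// -[leRHS]mul1r ler_pM//; case: eqP.
Qed.

(** This is s^2 I'' + (n - 1) s I' <= 0, where I(s) is the integral of [f] at [s] e over unit
    vectors e, with the derivatives written under the integral. *)
Lemma Rintegral_radial_le0 (s : R) :
  \int[sigma]_(e in S) (s ^+ 2 * d2f (fun l => s * tnth e l) (tnth e) (cst 0) +
     (n%:R - 1) * s * df (fun l => s * tnth e l) (tnth e)) <= 0 :> R.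
Proof.
pose v (e : n.-tuple R) l := s * tnth e l.
pose w (p : 'I_n * 'I_n) (e : n.-tuple R) l := s * rot_gen p.1 p.2 (tnth e) l.
pose z (p : 'I_n * 'I_n) (e : n.-tuple R) l :=
  s * rot_gen p.1 p.2 (rot_gen p.1 p.2 (tnth e)) l.
(* Two applications of a generator multiply the bound on the entries by at most 4. The summand 1
   covers the unit vector itself, which is the velocity in the radial direction. *)
pose M := `|s| * 4 + 1.
have M0 : 0 <= M by rewrite addr_ge0 ?mulr_ge0.
have [C bC] := qpow_bounded m0 quad_ge k0 M0.
have leM x : `|x| <= 4 -> `|s * x| <= M.
  by move=> x4; rewrite normrM ler_wpDr// ler_wpM2l.
have vM e l : S e -> `|v e l| <= M.
  by move=> Se; apply: leM; rewrite (le_trans (tnth_le1 l Se))// ler1n.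
have eM (e : n.-tuple R) l : S e -> `|tnth e l| <= M.
  by move=> Se; rewrite ler_wpDl ?tnth_le1// mulr_ge0.
have w2 p e l : S e -> `|rot_gen p.1 p.2 (tnth e) l| <= 1 * 2.
  by move=> Se; apply: rot_gen_le => l'; exact: tnth_le1.
have wM p e l : S e -> `|w p e l| <= M.
  by move=> Se; apply: leM; rewrite (le_trans (w2 _ _ _ Se))// mul1r ler_nat.
have zM p e l : S e -> `|z p e l| <= M.
  move=> Se; apply: leM; rewrite (le_trans (rot_gen_le _ _ (w2 p _ ^~ Se) _))//.
  by rewrite mul1r -natrM.
have mrot (h : n.-tuple R -> 'I_n -> R) i j l : (forall l,
  measurable_fun S (h ^~ l)) ->
    measurable_fun S (fun e => rot_gen i j (h e) l).
  by move=> mh; apply: measurable_funB; apply: measurable_funM.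
have mv l : measurable_fun S (v ^~ l) by exact: measurable_coord.
have mw p l : measurable_fun S (w p ^~ l).
  by apply: measurable_funM => //; exact: mrot.
have mz p l : measurable_fun S (z p ^~ l).
  by apply: measurable_funM => //; apply: (mrot) => l'; exact: mrot.
have Mz (l : 'I_n) : `|cst 0 l : R| <= M by rewrite normr0.
pose U p e := d2f (v e) (w p e) (z p e).
have intU p : sigma.-integrable S (EFin \o U p).
  apply: (@integrable_of_le _ _ _ _ _ mS Soo _ C);
    first exact: measurable_d2qpow.
  by move=> e Se; have [] := bC (v e) (w p e) (z p e); auto.
have U0 p : \int[sigma]_(e in S) U p e = 0.
  (* On the diagonal the generator is zero, hence so is the integrand. *)
  have [pp|pp] := eqVneq p.1 p.2; last exact: (integral_d2qpow_rot_gen s pp).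
  under eq_Rintegral => e _.
    rewrite (_ : U p e = 0); first over.
    have r0 h l : rot_gen p.1 p.2 h l = 0 by rewrite /rot_gen pp subrr.
    rewrite /U /d2qpow (_ : dquad _ _ _ _ = 0); last first.
      by rewrite /dquad big1 ?mulr0// => l _; rewrite /w r0 !mulr0.
    rewrite (_ : d2quad _ _ _ _ _ = 0) ?expr0n ?mulr0 ?addr0 ?mulr0//.
    rewrite /d2quad /dquad !big1 ?mulr0 ?addr0// => l _;
      first by rewrite /z r0 !mulr0.
    by apply: big1 => l' _; rewrite /w !r0 !(mulr0, mul0r).
  by rewrite Rintegral_cst// mul0r.
have intd2 : sigma.-integrable S (EFin \o (fun e =>
  s ^+ 2 * d2f (v e) (tnth e) (cst 0))).
  apply: (@integrable_of_le _ _ _ _ _ mS Soo _ (`|s ^+ 2| * C)).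
    by apply: measurable_funM => //; exact: measurable_d2qpow.
  move=> e Se; rewrite normrM ler_wpM2l//.
  by have [] := bC (v e) (tnth e) (cst 0); auto.
have intd1 : sigma.-integrable S (EFin \o (fun e =>
  (n%:R - 1) * s * df (v e) (tnth e))).
  apply: (@integrable_of_le _ _ _ _ _ mS Soo _ (`|(n%:R - 1) * s| * C)).
    by apply: measurable_funM => //; exact: measurable_dqpow.
  move=> e Se; rewrite [in leLHS]normrM ler_wpM2l//.
  by have [] := bC (v e) (tnth e) (cst 0); auto.
have intsum : sigma.-integrable S (EFin \o (fun e => \sum_p U p e)).
  rewrite (_ : _ \o _ = fun y => (\sum_p (EFin \o U p) y)%E).
    exact: integrable_sum.
  by apply/funext => y /=; rewrite sumEFin.
(* Dropping the nonpositive Laplacian from [qpow_radial] leaves the spherical part, whose integral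
   is 0. *)
apply: (@le_trans _ _ (\int[sigma]_(e in S) (- 2^-1 * \sum_p U p e)));
  last first.
  by rewrite RintegralZl// Rintegral_sum// big1 ?mulr0.
apply: le_Rintegral => //.
- rewrite /comp; under eq_fun do rewrite EFinD.
  exact: integrableD.
- rewrite /comp; under eq_fun do rewrite EFinM.
  exact: integrableZl.
move=> e Se; rewrite (qpow_radial s (unit_sphere_sum Se)).
rewrite pair_bigA /= mulNr -/(v e) gerDr.
by rewrite mulr_ge0_le0 ?sqr_ge0 ?(qpow_laplacian_le0 (superh _)).
Qed.

(** With I(s) the integral of [f] at s e, the integral of [K s] is (s - s^(n-1)) I'(s) + (n - 2)
    I(s). Its monotonicity on [0, 1] compares I(1) with I(0). *)
Lemma Rintegral_qpow_le : (2 < n)%N ->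
  \int[sigma]_(e in S) f (tnth e) <= f (cst 0) * fine (sigma S).
Proof.
move=> n2.
(* With this shift [N.+1] is n - 2 and [N.+2] is n - 1. *)
pose N := (n - 3)%N.
have nE : n%:R = N%:R + 3 :> R by rewrite -natrD subnK.
pose v (s : R) (e : n.-tuple R) l := s * tnth e l.
have [C bC] := qpow_bounded m0 quad_ge k0 (ler0n R 2).
have C0 : 0 <= C.
  have [] // := bC (cst 0) (cst 0) (cst 0); try by move=> l; rewrite normr0.
  by move=> h _ _; exact: le_trans h.
(* The open interval from -1 to 2 contains [0, 1], so that differentiation under the integral is
   available at both endpoints. *)
have b2 (s : R) : -1 < s < 2 -> `|s| <= 2.
  by move=> /andP[s1 s2]; rewrite ler_norml (ltW s2) andbT; apply: ltW; lra.
have vM (s : R) e l : -1 < s < 2 -> S e -> `|v s e l| <= 2.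
  move=> /b2 s2 Se; rewrite normrM -[2]mulr1; apply: ler_pM => //;
    exact: tnth_le1.
have eM (e : n.-tuple R) l : S e -> `|tnth e l| <= 2.
  by move=> Se; rewrite (le_trans (tnth_le1 l Se))// ler1n.
have Mz (l : 'I_n) : `|cst 0 l : R| <= 2 by rewrite normr0.
(* [p] vanishes at 0 and at 1, which removes the derivative of [f] from [K] at both endpoints. *)
pose p (s : R) := s - s ^+ N.+2.
pose p1 (s : R) := 1 - N.+2%:R * s ^+ N.+1.
pose K s e := p s * df (v s e) (tnth e) + N.+1%:R * f (v s e).
pose K1 s e := p1 s * df (v s e) (tnth e) + p s * d2f (v s e) (tnth e) (cst 0)
  + N.+1%:R * df (v s e) (tnth e).
have dv (s : R) e l : is_derive s 1 (fun t => v t e l) (tnth e l).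
  rewrite /v; apply: is_derive_eq (is_derive_mulf (is_derive_id _ _)
    (is_derive_cst _ _ _)) _.
  by rewrite /= mulr0 addr0 mul1r.
have de (s : R) (e : n.-tuple R) (l : 'I_n) : is_derive s 1 (fun t : R =>
  tnth e l) (cst 0 l).
  exact: is_derive_cst.
have dp (s : R) : is_derive s 1 p (p1 s).
  have dX : is_derive s 1 (fun t : R => t ^+ N.+2) (N.+2%:R * s ^+ N.+1).
    have h := @is_deriveX R R id N.+2 s 1 1 (is_derive_id s 1).
    by rewrite exprfctE in h; apply: is_derive_eq h _;
      rewrite /GRing.scale /= mulr1.
  exact: is_derive_addf (is_derive_id _ _) (is_deriveN dX).
have dK (s : R) e : is_derive s 1 (K ^~ e) (K1 s e).
  apply: is_derive_addf.
    apply: is_derive_mulf => //.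
    exact: (is_derive_dqpow symA k m0 quad_ge (g := v ^~ e) (w := fun=>
      tnth e)).
  apply: is_derive_mulcf.
  by apply: (is_derive_qpow symA k m0 quad_ge) => l; exact: dv.
have [B BK] : exists B, forall (s : R) e, -1 < s < 2 -> S e -> `|K s e| <=
  B /\ `|K1 s e| <= B.
  pose P : R := 2 + 2 ^+ N.+2; pose P1 : R := 1 + N.+2%:R * 2 ^+ N.+1.
  have P0 : 0 <= P by rewrite addr_ge0.
  have P10 : 0 <= P1 by rewrite addr_ge0// mulr_ge0.
  exists (P * C + P1 * C + N.+1%:R * C) => s e s12 Se.
  have [fC dfC d2fC] : [/\ `|f (v s e)| <= C, `|df (v s e) (tnth e)| <= C &
      `|d2f (v s e) (tnth e) (cst 0)| <= C] by apply: bC => l; auto.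
  have pP : `|p s| <= P.
    rewrite (le_trans (ler_normB _ _))// lerD ?b2// normrX lerXn2r ?nnegrE//;
      exact: b2.
  have p1P : `|p1 s| <= P1.
    rewrite (le_trans (ler_normB _ _))// normr1 lerD2l normrM ger0_norm//.
    rewrite ler_wpM2l// normrX lerXn2r ?nnegrE//; exact: b2.
  have PC : 0 <= P * C by rewrite mulr_ge0.
  have P1C : 0 <= P1 * C by rewrite mulr_ge0.
  have Nn : `|N.+1%:R : R| <= N.+1%:R by rewrite normr_nat.
  split.
    rewrite /K (le_trans (ler_normD _ _))// (normrM (p s))
      (normrM N.+1%:R) addrAC ler_wpDr//.
    by apply: lerD; apply: ler_pM.
  rewrite /K1 (le_trans (ler_normD _ _))// lerD//;
    last by rewrite (normrM N.+1%:R) ler_pM.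
  rewrite (le_trans (ler_normD _ _))// addrC (normrM (p s)) (normrM (p1 s)).
  by apply: lerD; apply: ler_pM.
have mv (s : R) l : measurable_fun S (fun e =>
  v s e l) by exact: measurable_coord.
have mK (s : R) : measurable_fun S (K s).
  apply: measurable_funD; apply: measurable_funM => //.
    exact: measurable_dqpow.
  exact: measurable_qpow.
have mK1 (s : R) : measurable_fun S (K1 s).
  apply: measurable_funD; first apply: measurable_funD;
    apply: measurable_funM => //.
  - exact: measurable_dqpow.
  - exact: measurable_d2qpow.
  - exact: measurable_dqpow.
have dI (s : R) : -1 < s < 2 ->
    is_derive s 1 (fun s =>
      \int[sigma]_(e in S) K s e) (\int[sigma]_(e in S) K1 s e).
  move=> s12; apply: (@is_derive_Rintegral _ _ _ sigma S mS Soo K K1 s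
    (-1) 2 B) => //.
  - by move=> t e t12 Se; have [] := BK t e t12 Se.
  - by move=> t e t12 Se; have [] := BK t e t12 Se.
have I1le0 (s : R) : 0 < s < 1 -> \int[sigma]_(e in S) K1 s e <= 0.
  move=> /andP[s0 s1].
  (* Since [p1 s] + n - 2 = (n - 1) (1 - s^(n-2)) and [p s] = s (1 - s^(n-2)), [K1] is [rr] times
     the radial integrand. *)
  pose rr := (1 - s ^+ N.+1) / s.
  have rr0 : 0 < rr by rewrite divr_gt0// subr_gt0 exprn_ilt1// ltW.
  have KE e : K1 s e = rr * (s ^+ 2 * d2f (v s e) (tnth e) (cst 0) +
     (n%:R - 1) * s * df (v s e) (tnth e)).
    rewrite /K1 /rr /p1 /p nE (exprSr s N.+1) -![in LHS]natr1.
    set D := df _ _; set D2 := d2f _ _ _; set x := s ^+ N.+1.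
    by field; rewrite gt_eqF.
  have intK1 : sigma.-integrable S (EFin \o K1 s).
    apply: (@integrable_of_le _ _ _ _ _ mS Soo _ B) => // e Se.
    by have [] := BK s e _ Se => //; lra.
  rewrite -(pmulr_rle0 _ (_ : 0 < rr^-1)) ?invr_gt0// -RintegralZl//.
  under eq_Rintegral do rewrite KE mulKf ?gt_eqF//.
  exact: (Rintegral_radial_le0 s).
have in12 (s : R) : 0 <= s <= 1 -> -1 < s < 2 by lra.
have h : \int[sigma]_(e in S) K 1 e <= \int[sigma]_(e in S) K 0 e.
  apply: (@ler0_derive1_nincr R (fun s => \int[sigma]_(e in S) K s e) 0 1) =>
    //.
  - move=> s; rewrite in_itv/= => /andP[s0 s1].
    by have [] := dI s; first by apply: in12; rewrite !ltW.
  - move=> s; rewrite in_itv/= => /andP[s0 s1].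
    rewrite derive1E; have [|_ ->] := dI s; first by apply: in12; rewrite !ltW.
    by apply: I1le0; rewrite s0.
  - apply: derivable_within_continuous => s; rewrite in_itv/= => s01.
    by have [] := dI s (in12 _ s01).
have K1E e : K 1 e = N.+1%:R * f (tnth e).
  rewrite /K /p expr1n subrr mul0r add0r; congr (_ * f _).
  by apply/funext => l; rewrite /v mul1r.
have K0E e : K 0 e = N.+1%:R * f (cst 0).
  rewrite /K /p expr0n subrr mul0r add0r; congr (_ * f _).
  by apply/funext => l; rewrite /v mul0r.
move: h; under eq_Rintegral do rewrite K1E.
under [leRHS]eq_Rintegral do rewrite K0E.
rewrite Rintegral_cst// RintegralZl//.
  by rewrite -mulrA ler_pM2l.
apply: (@integrable_of_le _ _ _ _ _ mS Soo _ C); first exact: measurable_qpow.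
move=> e Se; have [|||//] := bC (tnth e) (cst 0) (cst 0) => // l.
exact: eM.
Qed.

End sphere_mean_of_quadratic_power.

(** * Rank-one updates of the Gram determinant *)

(** Sylvester's identity: the block matrix [T] has two factorizations into block triangular
    matrices. *)
Lemma det_1D_mulC (R : comNzRingType) m n (A : 'M[R]_(m, n)) (B : 'M[R]_(n,
  m)) :
  \det (1%:M + A *m B) = \det (1%:M + B *m A).
Proof.
pose T := block_mx 1%:M (- A) B 1%:M.
have E1 : T = block_mx 1%:M 0 B 1%:M *m block_mx 1%:M (- A) 0 (1%:M + B *m A).
  by rewrite mulmx_block !(mul1mx, mul0mx, mulmx0, mulmx1, addr0,
    mulmxN) addrCA addNr addr0.
have E2 : T = block_mx 1%:M (- A) 0 1%:M *m block_mx (1%:M + A *m B) 0 B 1%:M.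
  by rewrite mulmx_block !(mul1mx, mul0mx, mulmx0, mulmx1, add0r, mulNmx) addrK.
have := congr1 determinant E1;
  rewrite E2 !det_mulmx !det_ublock !det_lblock !det1.
by rewrite !mul1r !mulr1 => <-.
Qed.

Lemma det_2by2 (R : comNzRingType) (A : 'M[R]_2) :
  \det A = A 0 0 * A 1 1 - A 0 1 * A 1 0.
Proof.
rewrite (expand_det_row _ 0) !big_ord_recl big_ord0 addr0 /cofactor !det_mx11
  !mxE /=.
rewrite !(expr0, expr1, mul1r, mulN1r, mulrN).
by congr (_ * A _ _ - A _ _ * A _ _); exact/val_inj.
Qed.

Section dot.
Context {R : realFieldType}.

Definition dot n (x y : 'cV[R]_n) : R := (x^T *m y) 0 0.

Lemma dotE n (x y : 'cV[R]_n) : dot x y = \sum_i x i 0 * y i 0.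
Proof. by rewrite /dot mxE; apply: eq_bigr => i _; rewrite mxE. Qed.

Lemma mulmx_dot n (x y : 'cV[R]_n) : x^T *m y = (dot x y)%:M.
Proof. exact: mx11_scalar. Qed.

Lemma dotC n (x y : 'cV[R]_n) : dot x y = dot y x.
Proof. by rewrite !dotE; apply: eq_bigr => i _; rewrite mulrC. Qed.

Lemma dotDr n (x y z : 'cV[R]_n) : dot x (y + z) = dot x y + dot x z.
Proof. by rewrite /dot mulmxDr mxE. Qed.

Lemma dotDl n (x y z : 'cV[R]_n) : dot (x + y) z = dot x z + dot y z.
Proof. by rewrite dotC dotDr !(dotC z). Qed.

Lemma dotZr n c (x y : 'cV[R]_n) : dot x (c *: y) = c * dot x y.
Proof. by rewrite /dot -scalemxAr mxE. Qed.

Lemma dotZl n c (x y : 'cV[R]_n) : dot (c *: x) y = c * dot x y.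
Proof. by rewrite dotC dotZr dotC. Qed.

Lemma dotNr n (x y : 'cV[R]_n) : dot x (- y) = - dot x y.
Proof. by rewrite -scaleN1r dotZr mulN1r. Qed.

Lemma dotNl n (x y : 'cV[R]_n) : dot (- x) y = - dot x y.
Proof. by rewrite dotC dotNr dotC. Qed.

Lemma dot_mull n m (A : 'M[R]_(m, n)) x y : dot (A *m x) y = dot x (A^T *m y).
Proof. by rewrite /dot trmx_mul mulmxA. Qed.

Lemma dot_ge0 n (x : 'cV[R]_n) : 0 <= dot x x.
Proof. by rewrite dotE sumr_ge0// => i _; rewrite -expr2 sqr_ge0. Qed.

Lemma dot_gt0 n (x : 'cV[R]_n) : x != 0 -> 0 < dot x x.
Proof.
rewrite lt_def dot_ge0 andbT; apply: contra => /eqP; rewrite dotE => x0.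
apply/eqP/matrixP => i j; rewrite ord1 mxE.
move/eqP: x0; rewrite psumr_eq0 => [/allP/(_ i)|l _];
  last by rewrite -expr2 sqr_ge0.
by rewrite mem_index_enum => /(_ isT); rewrite mulf_eq0 orbb => /eqP.
Qed.

Lemma dot_lin2 n (c d : R) (x y : 'cV[R]_n) :
  dot (c *: x + d *: y) (c *: x + d *: y) =
  c ^+ 2 * dot x x + 2 * c * d * dot x y + d ^+ 2 * dot y y.
Proof. by rewrite !(dotDr, dotDl, dotZr, dotZl) (dotC y x); ring. Qed.

(** With a = y^T W y, b = x^T W y and c = x^T W x, the form of [W] at a x - b y equals a (c a -
    b^2). *)
Lemma dot_CauchySchwarz n (W : 'M[R]_n) (x y : 'cV[R]_n) : W^T = W ->
  (forall z, 0 <= dot z (W *m z)) -> 0 < dot y (W *m y) ->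
  dot x (W *m y) ^+ 2 <= dot x (W *m x) * dot y (W *m y).
Proof.
move=> symW W0; set a := dot y _ => a0; set b := dot x _.
have := W0 (a *: x - b *: y).
have yx : dot y (W *m x) = b by rewrite dotC dot_mull symW.
rewrite mulmxBr -!scalemxAr !(dotDr, dotDl, dotNr, dotNl, dotZr,
  dotZl) yx -/a -/b.
set c := dot x _.
rewrite [leRHS](_ : _ = a * (c * a - b ^+ 2)); last by ring.
by rewrite pmulr_rge0// subr_ge0.
Qed.

End dot.

(** * The quadratic polynomial of a rank-one update *)

Section rank_one_direction.
Context {R : realFieldType}.
Variables (n p : nat) (X : 'M[R]_(n, p)) (rho : 'cV[R]_p) (beta : R).
Hypotheses (beta0 : 0 < beta) (rho0 : rho != 0).

Definition gram := X^T *m X + beta%:M.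

Lemma gram_tr : gram^T = gram.
Proof. by rewrite /gram linearD /= trmx_mul trmxK tr_scalar_mx. Qed.

Lemma dot_gram x y : dot x (gram *m y) = dot (X *m x) (X *m y) + beta * dot x y.
Proof. by rewrite mulmxDl dotDr mul_scalar_mx dotZr
  -mulmxA [in RHS]dot_mull. Qed.

(** A kernel vector v would satisfy 0 = v^T [gram] v >= beta |v|^2. *)
Lemma gram_unit : gram \in unitmx.
Proof.
rewrite unitmxE unitfE; apply/det0P => -[v v0 /(congr1 trmx)].
rewrite trmx_mul gram_tr trmx0 => Nv.
have : dot v^T (gram *m v^T) = 0 by rewrite Nv /dot mulmx0 mxE.
apply/eqP; rewrite dot_gram gt_eqF// ltr_wpDl ?dot_ge0// mulr_gt0// dot_gt0//.
by rewrite -(inj_eq (@trmx_inj _ _ _)) trmxK trmx0.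
Qed.

Let N := gram.
Let W := invmx N.
Let y := W *m rho.

Definition rank1_lin : 'cV[R]_n := X *m y.

Definition rank1_scale := dot rho y.

Definition rank1_mx : 'M[R]_n :=
  rank1_lin *m rank1_lin^T + rank1_scale *: (1%:M - X *m W *m X^T).

Local Notation g := rank1_lin.
Local Notation a := rank1_scale.
Local Notation A := rank1_mx.

Let WT : W^T = W. Proof. by rewrite /W trmx_inv gram_tr. Qed.
Let NW x : N *m (W *m x) = x :> 'cV_p. Proof. by rewrite mulmxA mulmxV
  ?gram_unit// mul1mx. Qed.
Let NWr k (x : 'M[R]_(p,
  k)) : N *m (W *m x) = x. Proof. by rewrite mulmxA mulmxV
  ?gram_unit// mul1mx. Qed.

Let W0 x : 0 <= dot x (W *m x).
Proof.
rewrite -{1}(NW x) dotC dot_gram addr_ge0 ?dot_ge0// mulr_ge0 ?dot_ge0 ?ltW//.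
Qed.

Let aE : a = dot g g + beta * dot y y.
Proof. by rewrite /rank1_scale -{1}(NW rho) dotC -/y dot_gram. Qed.

Let y0 : y != 0.
Proof. by apply: contraNneq rho0 => y0; rewrite -(NW rho) -/y y0 mulmx0. Qed.

Lemma rank1_scale_gt0 : 0 < a.
Proof. by rewrite aE ltr_wpDl ?dot_ge0// mulr_gt0// dot_gt0. Qed.

(** The ratio of the determinants of [gram] at X + v rho^T and at X, by [det_gram_rank1]. *)
Definition rank1_quad (v : 'cV[R]_n) := 1 + 2 * dot g v + dot v (A *m v).

Section at_v.
Variable v : 'cV[R]_n.
(** Ridge regression of [v] on the columns of [X]: [z] holds the coefficients, [t] is the residual,
    and [Xt] is the normal equation. *)
Let z := W *m (X^T *m v).
Let t := v - X *m z.
Let s := 1 + dot g v.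

Let Xt : X^T *m t = beta *: z.
Proof.
rewrite mulmxBr mulmxA -(NWr (X^T *m v)) -/z /N /gram mulmxDl mul_scalar_mx.
by rewrite addrC addKr.
Qed.

Let tz : dot t (X *m z) = beta * dot z z.
Proof. by rewrite dotC dot_mull Xt dotZr. Qed.

Let vE : v = t + X *m z. Proof. by rewrite subrK. Qed.

Let AvE : A *m v = dot g v *: g + a *: t.
Proof.
rewrite mulmxDl -mulmxA mulmx_dot mul_mx_scalar -scalemxAl mulmxBl mul1mx.
by rewrite -!mulmxA.
Qed.

Let gt : dot g t = beta * dot y z.
Proof. by rewrite /rank1_lin dot_mull Xt dotZr. Qed.

(** A sum of squares: 1 + 2 g.v + (g.v)^2 is [s ^+ 2], and the rest of v^T A v is a (v.t) with v.t =
    |t|^2 + beta |z|^2. *)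
Lemma rank1_quadE : rank1_quad v = s ^+ 2 + a * (dot t t + beta * dot z z).
Proof.
rewrite /rank1_quad AvE dotDr !dotZr (dotC v g).
have -> : dot v t = dot t t + beta * dot z z.
  by rewrite {1}vE dotDl (dotC _ t) tz.
by rewrite /s; ring.
Qed.

(** Half the gradient is s g + a t, and the right side minus the left side is beta |s y - a z|^2. *)
Lemma rank1_grad_le : dot (g + A *m v) (g + A *m v) <= a * rank1_quad v.
Proof.
rewrite rank1_quadE AvE.
have -> : g + (dot g v *: g + a *: t) = s *: g + a *: t.
  by rewrite addrA -{1}[g]scale1r -scalerDl.
have h := dot_ge0 (s *: y + (- a) *: z); rewrite dot_lin2 in h.
have gg : dot g g = a - beta * dot y y by rewrite aE addrK.
rewrite dot_lin2 gt gg -subr_ge0.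
apply: le_trans (mulr_ge0 (ltW beta0) h) _; rewrite le_eqVlt; apply/orP; left;
  apply/eqP.
by ring.
Qed.

(** Put d = rho.z. Then g.v = d, so the polynomial is at least (1 + d)^2 + a beta |z|^2, where |z|^2
    >= d^2 / |rho|^2 by Cauchy-Schwarz. The factor 1/2 is the minimum of (1 + d)^2 + d^2. *)
Lemma rank1_quad_ge :
  Num.min 1 (a * beta / dot rho rho) / 2 <= rank1_quad v.
Proof.
set m := Num.min _ _.
have r0 : 0 < dot rho rho by exact: dot_gt0.
have sc0 := rank1_scale_gt0.
have m1 : m <= 1 by rewrite ge_min lexx.
have mr : m * dot rho rho <= a * beta.
  by rewrite -ler_pdivlMr// ge_min lexx orbT.
have m0 : 0 < m by rewrite lt_min ltr01 divr_gt0// mulr_gt0 .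
have gv : dot g v = dot rho z.
  by rewrite /rank1_lin dot_mull -(NWr (X^T *m v))
    -/z dotC dot_mull gram_tr NW dotC.
have CS : dot rho z ^+ 2 <= dot rho rho * dot z z.
  have := @dot_CauchySchwarz _ _ 1%:M z rho (trmx1 _ _);
    rewrite !mul1mx mulrC (dotC z rho); apply => //.
  by move=> x; rewrite mul1mx dot_ge0.
rewrite rank1_quadE.
have tt := dot_ge0 t; have zz := dot_ge0 z.
have h1 : 1 <= 2 * s ^+ 2 + 2 * dot rho z ^+ 2.
  rewrite /s gv; set d := dot rho z.
  rewrite -subr_ge0 [leRHS](_ : _ = (1 + 2 * d) ^+ 2); last by ring.
  exact: sqr_ge0.
apply: (@le_trans _ _ (s ^+ 2 + a * beta * dot z z)); last first.
  by rewrite lerD2l mulrDr mulrA lerDr mulr_ge0// ltW.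
apply: (@le_trans _ _ (m * (s ^+ 2 + dot rho z ^+ 2))).
  by rewrite ler_pM2l//; move: h1; set S2 := s ^+ 2; set D2 := _ ^+ 2; lra.
rewrite mulrDr lerD//; first by rewrite ler_piMl ?sqr_ge0.
apply: (@le_trans _ _ (m * dot rho rho * dot z z)); last exact: ler_wpM2r.
by rewrite -mulrA ler_pM2l.
Qed.

End at_v.

(** The trace is |g|^2 + a (n - p + beta tr W). As |y|^2 <= a tr W, it is at least a (n - p) + |g|^2
    + beta |y|^2, and the last two terms add up to a. *)
Lemma rank1_trace_ge : (n%:R - p%:R + 1) * a <= \tr A.
Proof.
have trXWX : \tr (X *m W *m X^T) = p%:R - beta * \tr W.
  rewrite -mulmxA mxtrace_mulC -mulmxA (_ : X^T *m X = N - beta%:M);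
    last by rewrite addrK.
  rewrite mulmxBr mulVmx
    ?gram_unit// mul_mx_scalar linearB /= mxtrace1 linearZ /=.
  by [].
have -> : \tr A = dot g g + a * (n%:R - (p%:R - beta * \tr W)).
  rewrite /rank1_mx linearD /= linearZ /= linearB /= mxtrace1 trXWX;
    congr (_ + _).
  by rewrite mxtrace_mulC mulmx_dot mxtrace_scalar.
(* Cauchy-Schwarz for the form of [W], applied to [rho] and each basis vector, gives y_i^2 <= a
   W_ii. *)
have yW : dot y y <= a * \tr W.
  rewrite dotE /mxtrace mulr_sumr; apply: ler_sum => i _.
  pose ei : 'cV[R]_p := delta_mx i 0.
  have eiE (w : 'cV[R]_p) : dot ei w = w i 0.
    rewrite dotE (bigD1 i)//= big1 ?addr0; last first.
      by move=> l li; rewrite mxE (negbTE li) mul0r.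
    by rewrite mxE !eqxx mul1r.
  have := dot_CauchySchwarz ei WT W0 rank1_scale_gt0; rewrite eiE -expr2 mulrC;
    congr (_ <= _ * _).
  by rewrite eiE -colE mxE.
rewrite aE in yW *.
have := ltW beta0; nra.
Qed.

End rank_one_direction.

Lemma det_block11 (R : comNzRingType) (a b c d : 'M[R]_1) :
  \det (block_mx a b c d) = a 0 0 * d 0 0 - b 0 0 * c 0 0.
Proof.
rewrite (det_2by2 (block_mx a b c d : 'M[R]_2)).
have -> : (0 : 'I_2) = lshift 1 (0 : 'I_1) by exact/val_inj.
have -> : (1 : 'I_2) = rshift 1 (0 : 'I_1) by exact/val_inj.
congr (_ * _ - _ * _); [exact: block_mxEul|exact: block_mxEdr|exact:
  block_mxEur|
  exact: block_mxEdl].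
Qed.

Section det_rank_one.
Context {R : realFieldType}.
Variables (n p : nat) (X : 'M[R]_(n, p)) (rho : 'cV[R]_p) (beta : R).
Hypothesis (beta0 : 0 < beta).

(** The update changes the Gram matrix by a matrix of rank at most two; Sylvester's identity reduces
    its effect to a determinant of size 2. *)
Lemma det_gram_rank1 (v : 'cV[R]_n) :
  \det (gram (X + v *m rho^T) beta) = \det
    (gram X beta) * rank1_quad X rho beta v.
Proof.
pose N := gram X beta; pose W := invmx N.
have uN : N \in unitmx by exact: gram_unit.
have WT : W^T = W by rewrite /W trmx_inv gram_tr.
pose u := X^T *m v; pose d := dot v v.
(* The change u rho^T + rho u^T + d rho rho^T equals rho (u + d rho)^T + u rho^T, that is,
   [U *m V]. *)
pose U : 'M[R]_(p, 1 + 1) := row_mx rho u.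
pose V : 'M[R]_(1 + 1, p) := col_mx (u + d *: rho)^T rho^T.
have -> : gram (X + v *m rho^T) beta = N *m (1%:M + (W *m U) *m V).
  rewrite mulmxDr mulmx1 -mulmxA mulKVmx//.
  rewrite /gram /N /gram addrAC; congr (_ + _).
  have -> : (X + v *m rho^T)^T = X^T + rho *m v^T by rewrite linearD /=
    trmx_mul trmxK.
  have Vt : (u + d *: rho)^T = v^T *m X + d *: rho^T.
    by rewrite linearD linearZ /= /u trmx_mul trmxK.
  rewrite /U /V mul_row_col Vt mulmxDl !mulmxDr -/u !mulmxA.
  rewrite -(mulmxA rho v^T v) mulmx_dot -/d mul_mx_scalar -scalemxAl -scalemxAr.
  by rewrite -!addrA; congr (_ + _); rewrite addrC -addrA.
rewrite det_mulmx det_1D_mulC; congr (_ * _).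
rewrite /V /U mul_mx_row mul_col_row scalar_mx_block add_block_mx.
rewrite det_block11 !add0r.
have addE (B : 'M[R]_1) :
  (1%:M + B) 0 0 = 1 + B 0 0 by rewrite mxE [X in X + _]mxE.
rewrite !addE.
have -> : ((u + d *: rho)^T *m (W *m rho)) 0 0 = dot (u + d *: rho)
  (W *m rho) by [].
have -> : ((u + d *: rho)^T *m (W *m u)) 0 0 = dot (u + d *: rho)
  (W *m u) by [].
have -> : (rho^T *m (W *m rho)) 0 0 = dot rho (W *m rho) by [].
have -> : (rho^T *m (W *m u)) 0 0 = dot rho (W *m u) by [].
set g := X *m (W *m rho); set a := dot rho (W *m rho).
have gv : dot g v = dot u (W *m rho) by rewrite /g dot_mull dotC.
have gv' : dot rho (W *m u) = dot u (W *m rho) by rewrite dotC dot_mull WT.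
have -> : rank1_quad X rho beta v = 1 + 2 * dot g v + dot v
  (dot g v *: g + a *: (v - X *m (W *m u))).
  rewrite /rank1_quad /rank1_mx /rank1_lin /rank1_scale -/N -/W -/g -/a;
    congr (_ + dot v _).
  rewrite mulmxDl -mulmxA mulmx_dot mul_mx_scalar -scalemxAl mulmxBl mul1mx.
  by rewrite -!mulmxA.
rewrite !(dotDr, dotZr, dotNr, dotDl, dotZl) -/a (dotC v g) gv gv'.
have -> : dot v (X *m (W *m u)) = dot u (W *m u) by rewrite dotC dot_mull dotC
  -/u dotC.
by rewrite -/d; ring.
Qed.

End det_rank_one.

(** * Positivity of the Gram determinant *)

Section gram_pos.
Context {R : realType}.

Lemma cvg_det (T : Type) (F : set_system T) (FF : Filter F) p
    (f : T -> 'M[R]_p) (A : 'M[R]_p) :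
  (forall i j, f t i j @[t --> F] --> A i j) -> \det (f t) @[t --> F] -->
    \det A.
Proof.
move=> fA; rewrite /determinant; apply: cvg_big => [|s _];
  first exact: add_continuous.
apply: cvgM; first exact: cvg_cst.
by apply: cvg_big => [|i _]; [exact: mul_continuous|exact: fA].
Qed.

(** Along the segment t X the determinant is continuous, equals beta^p at t = 0 and never vanishes,
    so it stays positive up to t = 1. *)
Lemma det_gram_gt0 n p (X : 'M[R]_(n, p)) (beta : R) : 0 < beta ->
  0 < \det (gram X beta).
Proof.
move=> beta0; rewrite ltNge; apply/negP => D0.
pose f (t : R) := \det (gram (t *: X) beta).
have cf : continuous f.
  move=> t; apply: cvg_det => i j.
  have E (u : R) : gram (u *: X) beta i j = u ^+ 2 *
    (X^T *m X) i j + beta%:M i j.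
    have -> : gram (u *: X) beta = u ^+ 2 *: (X^T *m X) + beta%:M.
      rewrite /gram (_ : (u *: X)^T = u *: X^T); last exact: linearZ.
      by rewrite -scalemxAl -scalemxAr scalerA.
    by rewrite mxE; congr (_ + _); rewrite mxE.
  rewrite E; under eq_fun do rewrite E.
  apply: cvgD; last exact: cvg_cst.
  apply: cvgM; last exact: cvg_cst.
  exact: exprn_continuous.
have f0 : f 0 = beta ^+ p by rewrite /f /gram scale0r mulmx0 add0r det_scalar.
have f1 : f 1 = \det (gram X beta) by rewrite /f scale1r.
have [] := @IVT R f 0 1 0 ler01.
- by apply: continuous_subspaceT.
- rewrite f0 f1; apply/andP; split; first by rewrite ge_min D0 orbT.
  by rewrite le_max exprn_ge0// ltW.
move=> t _ ft0; have := gram_unit (t *: X) beta0.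
by rewrite unitmxE -/(f t) ft0 unitr0.
Qed.

End gram_pos.

(** * Matrix superharmonicity of the prior *)

Section extended_power.
Context {R : realType}.

(** The prior as a function of the determinant alone, [c] being half of alpha + n + p - 1. *)
Definition neg_pow (c d : R) : \bar R :=
  if (d == 0) && (0 < c) then +oo%E else (d `^ (- c))%:E.

Lemma neg_pow_ge0 c d : (0 <= neg_pow c d)%E.
Proof. by rewrite /neg_pow; case: ifP => _;
  rewrite ?leey// lee_fin powR_ge0. Qed.

Lemma neg_pow0 d : neg_pow 0 d = 1%E.
Proof. by rewrite /neg_pow ltxx andbF oppr0 powRr0. Qed.

Lemma neg_pow_fin c d : d != 0 -> neg_pow c d = (d `^ (- c))%:E.
Proof. by rewrite /neg_pow => /negbTE->. Qed.

(** Continuity into the extended reals on the half-line d >= 0; at 0 with [0 < c] this is divergence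
    to [+oo]. It serves both lower semicontinuity and the passage to beta = 0. *)
Lemma cvg_neg_pow (T : Type) (F : set_system T) (FF : Filter F) (c d0 : R)
  (d : T -> R) :
  0 <= c -> 0 <= d0 -> (\forall t \near F, 0 <= d t) -> d t @[t --> F] --> d0 ->
  neg_pow c (d t) @[t --> F] --> neg_pow c d0.
Proof.
rewrite le_eqVlt => /orP[/eqP <-|c0] d00 dge0 dd0.
  by under eq_fun do rewrite neg_pow0; rewrite neg_pow0; exact: cvg_cst.
move: d00; rewrite le_eqVlt => /orP[/eqP d00|d00].
  rewrite /neg_pow -d00 eqxx c0 /=; apply/cvgeyPgt => A.
  pose B := Num.max A 1.
  have B0 : 0 < B by rewrite lt_max ltr01 orbT.
  (* Below this threshold the power with exponent -c exceeds [B], which is positive and at least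
     [A]. *)
  have dl0 : 0 < B `^ (- c^-1) by rewrite powR_gt0.
  have nd : \forall t \near F, d t < B `^ (- c^-1).
    by apply: (cvgr_lt d0) dd0 _ _; rewrite -d00.
  apply: filterS2 dge0 nd => t dt0 dtB; case: ifPn; first by rewrite ltry.
  rewrite andbT => dn0; have dp : 0 < d t by rewrite lt_def dn0.
  rewrite lte_fin (@le_lt_trans _ _ B)//; first by rewrite le_max lexx.
  rewrite powRN -[B]invrK ltf_pV2 ?posrE ?powR_gt0 ?invr_gt0//.
  have := gt0_ltr_powR c0 _ _ dtB; rewrite -powRrM mulNr mulVf ?gt_eqF//.
  by rewrite powR_inv1 ?(ltW B0)//; apply; rewrite nnegrE ltW.
have nd : \forall t \near F, 0 < d t by apply: (cvgr_gt d0) dd0 _ _.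
rewrite neg_pow_fin ?gt_eqF//; apply: cvg_EFin.
  by apply: filterS nd => t dt; rewrite neg_pow_fin ?gt_eqF.
have h : d t `^ (- c) @[t --> F] --> d0 `^ (- c).
  have [dp _] := is_derive1_powR (- c) d00.
  have cp : {for d0, continuous (fun x : R => x `^ (- c))}.
    exact/differentiable_continuous/derivable1_diffP.
  exact: (continuous_cvg FF cp dd0).
apply: cvg_trans h; apply: near_eq_cvg.
by apply: filterS nd => t dt; rewrite /= neg_pow_fin ?gt_eqF.
Qed.

End extended_power.

Section prior.
Context {R : realType}.

Lemma priorE n p (alpha beta : R) (M : 'M[R]_(n, p)) :
  prior alpha beta M =
  neg_pow ((alpha + n%:R + p%:R - 1) / 2) (\det (gram M beta)).
Proof.
by rewrite /prior /neg_pow -/(gram M beta) pmulr_lgt0 ?invr_gt0// mulNr.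
Qed.

Lemma det_gram_continuous n p (beta : R) :
  continuous (fun M : 'M[R]_(n, p) => \det (gram M beta)).
Proof.
move=> M; apply: (cvg_det (nbhs_filter M)) => i j.
have E (K : 'M[R]_(n, p)) : gram K beta i j =
  (\sum_l K l i * K l j) + beta%:M i j.
  by rewrite /gram mxE; congr (_ + _); rewrite mxE; apply: eq_bigr => l _;
    rewrite mxE.
rewrite E; under eq_fun do rewrite E.
apply: cvgD; last exact: cvg_cst.
apply: cvg_big => [|l _]; first exact: add_continuous.
by apply: cvgM; exact: coord_continuous.
Qed.

Lemma cvg_det_gram n p (M : 'M[R]_(n, p)) (b : nat -> R) (b0 : R) :
  b m @[m --> \oo] --> b0 -> \det (gram M (b m)) @[m --> \oo] -->
    \det (gram M b0).
Proof.
move=> bb0; apply: cvg_det => i j.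
have E (c : R) : gram M c i j = (M^T *m M) i j + c *+ (i == j).
  by rewrite /gram mxE; congr (_ + _); rewrite mxE.
rewrite E; under eq_fun do rewrite E.
by apply: cvgD; [exact: cvg_cst|case: (i == j) => //; exact: cvg_cst].
Qed.

(** For [beta = 0] the determinant is the limit of the positive determinants at 1 / (m + 1). *)
Lemma det_gram_ge0 n p (M : 'M[R]_(n, p)) (beta : R) : 0 <= beta ->
  0 <= \det (gram M beta).
Proof.
rewrite le_eqVlt => /orP[/eqP <-|b0]; last by rewrite ltW// det_gram_gt0.
have h : \det (gram M (harmonic m)) @[m --> \oo] --> \det (gram M 0).
  by apply: cvg_det_gram; exact: cvg_harmonic.
rewrite -(cvg_lim _ h)//; apply: limr_ge; first by apply/cvg_ex; eexists;
  exact: h.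
by apply: nearW => m; rewrite ltW// det_gram_gt0// harmonic_gt0.
Qed.

End prior.

(** * Spherical means of powers of the Gram determinant *)

Section spherical_means.
Context {R : realType}.
Variables (n p : nat) (X : 'M[R]_(n, p)) (rho : 'cV[R]_p) (c : R).
Hypotheses (c0 : 0 <= c) (cnp : 2 * (c + 1) <=
  n%:R - p%:R + 1) (n2 : (2 < n)%N).

Local Notation S := (unit_sphere R n).
Local Notation sigma := (surface_measure R n).
Local Notation shifted e := (X + (\col_i tnth e i) *m rho^T).

Let mS : measurable S := @measurable_unit_sphere R n.
Let Soo : (sigma S < +oo)%E := surface_measure_lty mS.

Section positive_beta.
Variable beta : R.
Hypothesis beta0 : 0 < beta.

Let b i := rank1_lin X rho beta i 0.
Let A i j := rank1_mx X rho beta i j.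
Let D := \det (gram X beta).

Lemma rank1_quad_sum (v : 'I_n -> R) :
  rank1_quad X rho beta (\col_i v i) = quad 1 b A v.
Proof.
rewrite /rank1_quad /quad; congr (_ + 2 * _ + _).
  by rewrite dotE; apply: eq_bigr => i _; rewrite [X in _ * X]mxE.
rewrite dotE; apply: eq_bigr => i _;
  rewrite [X in X * _]mxE [X in _ * X]mxE mulr_sumr.
by apply: eq_bigr => j _; rewrite [X in _ * (_ * X)]mxE -/(A i j) mulrCA.
Qed.

Lemma rank1_grad_sum (v : 'I_n -> R) :
  \sum_i hgrad b A v i ^+ 2 =
  dot (rank1_lin X rho beta + rank1_mx X rho beta *m \col_i v i)
      (rank1_lin X rho beta + rank1_mx X rho beta *m \col_i v i).
Proof.
rewrite dotE; apply: eq_bigr => i _; rewrite -expr2; congr (_ ^+ 2).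
rewrite mxE; congr (_ + _); rewrite mxE.
by apply: eq_bigr => j _; rewrite [X in _ = _ * X]mxE.
Qed.

Lemma rank1_mx_sym i j : A i j = A j i.
Proof.
suff H : (rank1_mx X rho beta)^T = rank1_mx X rho beta by rewrite /A -{1}H mxE.
rewrite /rank1_mx linearD linearZ linearB /= trmx1 !trmx_mul !trmxK trmx_inv
  gram_tr.
by rewrite [in LHS]mulmxA [in RHS]mulmxA -!mulmxA.
Qed.

Lemma det_gram_shifted e :
  \det (gram (shifted e) beta) = D * quad 1 b A (tnth e).
Proof. by rewrite det_gram_rank1// rank1_quad_sum. Qed.

Let D0 : 0 < D := det_gram_gt0 X beta0.

Let quad0 e : 0 < quad 1 b A (tnth e).
Proof. by have := det_gram_gt0 (shifted e) beta0;
  rewrite det_gram_shifted pmulr_rgt0. Qed.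

Lemma neg_pow_shifted e :
  neg_pow c (\det (gram (shifted e) beta)) =
  (D `^ (- c) * qpow 1 b A c (tnth e))%:E.
Proof.
rewrite neg_pow_fin; last by rewrite gt_eqF// det_gram_gt0.
by rewrite det_gram_shifted powRM ?ltW.
Qed.

Let measurable_qpow_tnth : measurable_fun S (fun e => qpow 1 b A c (tnth e)).
Proof.
apply: measurable_qpow => i; apply: measurable_funTS; exact: measurable_tnth.
Qed.

Lemma measurable_neg_pow_shifted :
  measurable_fun S (fun e => neg_pow c (\det (gram (shifted e) beta))).
Proof.
under eq_fun do rewrite neg_pow_shifted.
by apply/measurable_EFinP; apply: measurable_funM.
Qed.

(** The integrand is [D] to the power -c times [qpow] of the rank-one polynomial, to which
    [Rintegral_qpow_le] applies; that polynomial is 1 at the origin. *)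
Lemma sphere_integral_neg_pow_le :
  (\int[sigma]_(e in S) neg_pow c (\det (gram (shifted e) beta)) <=
   neg_pow c D * sigma S)%E.
Proof.
(* For [rho = 0] the integrand is constant; the lower bound [m] below divides by |rho|^2. *)
have [r0|r0] := eqVneq rho 0.
  have E e : neg_pow c (\det (gram (shifted e) beta)) = neg_pow c D.
    by rewrite r0 trmx0 mulmx0 addr0.
  under eq_integral do rewrite E.
  by rewrite integral_cst.
pose m := Num.min 1 (rank1_scale X rho beta * beta / dot rho rho) / 2.
have quad_ge v : m <= quad 1 b A v.
  by rewrite -rank1_quad_sum rank1_quad_ge.
have q0 : quad 1 b A (cst 0) = 1.
  rewrite /quad big1 ?mulr0 ?addr0 => [|i _]; last by rewrite mulr0.
  by rewrite big1 ?addr0// => i _; rewrite big1// => j _; rewrite !mulr0.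
have a0 : 0 < rank1_scale X rho beta.
  exact: rank1_scale_gt0.
have m0 : 0 < m.
  by rewrite divr_gt0// lt_min ltr01 divr_gt0 ?mulr_gt0// dot_gt0.
(* With q the polynomial: 2 (c + 1) |half gradient|^2 <= 2 (c + 1) a q <= (n - p + 1) a q <= q tr
   A. *)
have superh v : 2 * (c + 1) * (\sum_i hgrad b A v i ^+ 2) <=
  quad 1 b A v * \sum_i A i i.
  have qv : 0 < quad 1 b A v := lt_le_trans m0 (quad_ge v).
  rewrite rank1_grad_sum; have := rank1_grad_le X rho beta0 (\col_i v i).
  rewrite rank1_quad_sum => h1.
  have h2 : (n%:R - p%:R + 1) * rank1_scale X rho beta <= \sum_i A i i :=
    rank1_trace_ge X beta0 r0.
  apply: (le_trans (ler_wpM2l _ h1)); first by rewrite mulr_ge0 ?addr_ge0.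
  rewrite mulrA [leRHS]mulrC ler_pM2r//; apply: le_trans h2.
  by rewrite ler_wpM2r// ltW.
have h := Rintegral_qpow_le rank1_mx_sym c0 m0 quad_ge superh n2.
have [C bC] := qpow_bounded m0 quad_ge c0 ler01.
have intq : sigma.-integrable S (EFin \o (fun e => qpow 1 b A c (tnth e))).
  apply: (integrable_of_le mS Soo measurable_qpow_tnth (C := C)) => e Se.
  have [|||//] := bC (tnth e) (cst 0) (cst 0) => i; rewrite ?normr0//.
  by rewrite -Se; exact: tnth_le_eucl_norm.
under eq_integral do rewrite neg_pow_shifted EFinM.
rewrite ge0_integralZl//; first last.
- by rewrite lee_fin powR_ge0.
- by move=> e _; rewrite lee_fin powR_ge0.
- exact/measurable_EFinP.
rewrite neg_pow_fin ?gt_eqF//; apply: lee_wpmul2l;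
  first by rewrite lee_fin powR_ge0.
rewrite -[leLHS]fineK ?integrable_fin_num// -[leRHS]fineK ?ge0_fin_numE//.
by rewrite lee_fin (le_trans h)// /qpow q0 powR1 mul1r.
Qed.

End positive_beta.

Lemma sphere_mean_neg_pow_le (beta : R) : 0 <= beta ->
  (sphere_mean (fun M : 'M[R]_(n, p) => neg_pow c (\det (gram M beta))) X rho <=
   neg_pow c (\det (gram X beta)))%E.
Proof.
move=> beta0; rewrite /sphere_mean /surface_area.
have Sfin : sigma S \is a fin_num by rewrite ge0_fin_numE.
have I_le : neg_pow c (\det (gram X beta)) != +oo%E ->
    (\int[sigma]_(e in S) neg_pow c (\det (gram (shifted e) beta)) <=
     neg_pow c (\det (gram X beta)) * sigma S)%E.
  move=> foo; move: beta0; rewrite le_eqVlt => /orP[/eqP b0|];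
    last exact: sphere_integral_neg_pow_le.
  (* For [beta = 0] the functions with parameter 1 / (m + 1) converge pointwise, to [+oo] where the
     limit is infinite. *)
  have cvf (M : 'M[R]_(n, p)) : neg_pow c (\det (gram M (harmonic m))) @[m -->
    \oo] -->
      neg_pow c (\det (gram M beta)).
    apply: cvg_neg_pow => //; first by rewrite det_gram_ge0// b0.
      by apply: nearW => m; rewrite det_gram_ge0// harmonic_ge0.
    by apply: cvg_det_gram; rewrite -b0; exact: cvg_harmonic.
  pose u m := (\int[sigma]_(e in S) neg_pow c (\det (gram (shifted e)
    (harmonic m))))%E.
  pose v m := (neg_pow c (\det (gram X (harmonic m))) * sigma S)%E.
  have cv : v m @[m --> \oo] --> (neg_pow c (\det (gram X beta)) * sigma S)%E.
    by apply: cvgeZr => //; exact: cvf.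
  have -> : (\int[sigma]_(e in S) neg_pow c (\det (gram (shifted e) beta)) =
      \int[sigma]_(e in S) limn_einf (fun m =>
        neg_pow c (\det (gram (shifted e) (harmonic m)))))%E.
    by apply: eq_integral => e _;
      have [-> _] := cvg_limn_einf_sup (cvf (shifted e)).
  (* Fatou's lemma bounds the integral by the lower limit of [u]; each [u m] is at most [v m], and
     [v] converges to the right side. *)
  apply: (@le_trans _ _ (limn_einf u)).
    apply: fatou => //= [m|m e _]; last exact: neg_pow_ge0.
    by apply: measurable_neg_pow_shifted; exact: harmonic_gt0.
  rewrite -(cvg_lim _ cv)// limn_einf_lim; apply: lee_lim.
  - exact: is_cvg_einfs.
  - by apply/cvg_ex; eexists; exact: cv.
  - apply: nearW => m; apply: (@le_trans _ _ (u m)).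
      by apply: ereal_inf_lbound; exists m => /=.
    by apply: sphere_integral_neg_pow_le; exact: harmonic_gt0.
have [->|foo] := eqVneq (neg_pow c (\det (gram X beta))) +oo%E;
  first by rewrite leey.
apply: (@le_trans _ _ (((fine (sigma S))^-1)%:E * (neg_pow c (\det
  (gram X beta)) * sigma S))%E).
  by apply: lee_wpmul2l (I_le foo); rewrite lee_fin invr_ge0 fine_ge0.
have f0 := neg_pow_ge0 c (\det (gram X beta)).
rewrite -[sigma S in leLHS]fineK// muleCA -EFinM.
(* With area 0 the left side would be 0, which is at most the nonnegative right side. *)
have [->|s0] := eqVneq (fine (sigma S)) 0; first by rewrite mulr0 mule0.
by rewrite mulVf// mule1.
Qed.

End spherical_means.

Theorem theorem4p9 (R : realType) (n p : nat) (alpha beta : R)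
  (hn : (1 <= n)%N) (hp : (1 <= p)%N)
  (hnp : (0 < n%:Z - p%:Z - 1)%R)
  (halpha_ge : - n%:R - p%:R + 1 <= alpha)
  (halpha_le : alpha <= - (2 * p%:R))
  (hbeta : 0 <= beta) :
  matrix_superharmonic (fun M : 'M[R]_(n, p) => prior alpha beta M).
Proof.
pose c := (alpha + n%:R + p%:R - 1) / 2.
have pn : (p.+1 < n)%N by move: hnp; lia.
(* The lower bound on [alpha] gives [c0], the upper bound gives [cnp]. *)
have c0 : 0 <= c by rewrite /c; lra.
have cnp : 2 * (c + 1) <= n%:R - p%:R + 1 by rewrite /c; lra.
have -> : (fun M : 'M[R]_(n, p) => prior alpha beta M) =
    (fun M => neg_pow c (\det (gram M beta))) by apply/funext => M;
      exact: priorE.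
split.
- by move=> M; rewrite gt_eqF// (lt_le_trans _ (neg_pow_ge0 _ _)).
(* The function is continuous into the extended reals, so the set where it exceeds [a] is a
   neighbourhood of [M]. *)
- move=> M a aM.
  have cM : neg_pow c (\det (gram N beta)) @[N --> M] -->
    neg_pow c (\det (gram M beta)).
    apply: (cvg_neg_pow (nbhs_filter M)) => //; first exact: det_gram_ge0.
      by apply: nearW => N; exact: det_gram_ge0.
    exact: det_gram_continuous.
  exists [set N | (a%:E < neg_pow c (\det (gram N beta)))%E] => //.
  exact: (cM [set u | (a%:E < u)%E] (open_ereal_gt' aM)).
(* As p <= n, the columns are orthonormal and the Gram matrix is 1 + beta times the identity, which
   is invertible even for [beta = 0]. *)
- exists (pid_mx p); rewrite /gram tr_pid_mx mul_pid_mx.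
  rewrite (_ : minn n _ = p) ?pid_mx_1; last by lia.
  have b1 : 0 < 1 + beta by rewrite ltr_pwDl.
  by rewrite -raddfD det_scalar neg_pow_fin// expf_neq0// gt_eqF.
- by move=> X rho; apply: sphere_mean_neg_pow_le => //; lia.
Qed.
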